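(* For any $k\in\mathbb{N}$, any sufficiently small $\alpha,\varepsilon>0$ and all $m\in\mathbb{N}$, \[ n_m^{\mathrm{DD}k(\alpha)}(\varepsilon,\delta=0)=\tilde{\Theta}\left(\frac{k}{\varepsilon}+\frac{k}{\alpha\varepsilon\sqrt{m}}+\frac{k}{\alpha^2 m}\right). \]
   Context: User-level DP: there are $n$ users each holding $m$ examples from a domain $\mathcal{Z}$; two inputs in $\mathcal{Z}^{nm}$ are user-level neighbors if they differ only in one user's $m$ examples; an algorithm with finite output set is $(\varepsilon,\delta)$-user-level DP if $\Pr[\mathbf{A}(\mathbf{x})\in S]\le e^\varepsilon\Pr[\mathbf{A}(\mathbf{x}')\in S]+\delta$ for all neighbors and all output sets $S$. For a task with correct-answer sets $\Psi(\mathcal{D})$, $n_m(\varepsilon,\delta)$ is the smallest $n$ such that some $(\varepsilon,\delta)$-user-level DP algorithm, given $nm$ i.i.d. samples from $\mathcal{D}$ grouped into $n$ users, outputs an element of $\Psi(\mathcal{D})$ with probability at least $2/3$ for every valid $\mathcal{D}$. The task $\mathrm{DD}k(\alpha)$ (discrete distribution learning): $\mathcal{Z}=[k]$, every distribution $\mathcal{D}$ on $[k]$ is valid, and a correct output is a distribution $\mathcal{Q}$ with $d_{\mathrm{TV}}(\mathcal{Q},\mathcal{D})\le\alpha$. $\tilde{\Theta}$ hides factors polylogarithmic in the relevant parameters (including $1/\alpha$).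
   Formalization: The formal theorem takes k ≥ 2 (and m ≥ 1): for k = 1 there is only one distribution on [k], so a constant output is private and correct with no users, while the formula is at least 1/ε; for k = 0 there is no distribution. *)

(* Defs.v *)
From HB Require Import structures.
From mathcomp Require Import all_boot all_order all_algebra.
From mathcomp Require Import finmap.
From mathcomp Require Import reals sequences exp.

Set Implicit Arguments.
Unset Strict Implicit.
Unset Printing Implicit Defensive.

Import Order.TTheory GRing.Theory Num.Theory.
Local Open Scope ring_scope.

Definition is_fdist (R : realType) (T : finType) (f : {ffun T -> R}) : bool :=
  [forall t, 0 <= f t] && (\sum_t f t == 1).

Record fdist (R : realType) (T : finType) := FDist {
  fdist_fun :> {ffun T -> R};
  _ : is_fdist fdist_fun
}.

HB.instance Definition _ (R : realType) (T : finType) :=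
  [isSub for @fdist_fun R T].
HB.instance Definition _ (R : realType) (T : finType) :=
  [Choice of fdist R T by <:].

Definition Pr (R : realType) (T : finType) (P : fdist R T) (S : {set T}) : R :=
  \sum_(t in S) P t.

Definition dTV (R : realType) (T : finType) (P Q : fdist R T) : R :=
  2%:R^-1 * \sum_t `|P t - Q t|.

(* An input is an n x m matrix whose i-th row lists the m examples of user i. *)
Definition user_neighbors (Z : finType) (n m : nat) (x x' : 'M[Z]_(n, m)) :
    Prop :=
  exists i : 'I_n, forall i' : 'I_n, i' != i -> row i' x = row i' x'.

Definition user_level_DP (R : realType) (Z O : finType) (n m : nat)
    (eps delta : R) (A : 'M[Z]_(n, m) -> fdist R O) : Prop :=
  forall x x' : 'M[Z]_(n, m), user_neighbors x x' ->
  forall S : {set O}, Pr (A x) S <= expR eps * Pr (A x') S + delta.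

Definition iid_prob (R : realType) (Z : finType) (n m : nat) (D : fdist R Z)
    (x : 'M[Z]_(n, m)) : R :=
  \prod_i \prod_j D (x i j).

Record task (R : realType) := Task {
  domain : finType;
  answer : choiceType;
  valid : fdist R domain -> Prop;
  correct : fdist R domain -> pred answer
}.

(* The finite output set of the algorithm is a finite set of answers. *)
Definition success_prob (R : realType) (t : task R) (n m : nat)
    (O : {fset answer t}) (A : 'M[domain t]_(n, m) -> fdist R O)
    (D : fdist R (domain t)) : R :=
  \sum_x iid_prob D x * Pr (A x) [set o : O | correct D (val o)].

Definition solvable_with (R : realType) (t : task R) (m : nat) (eps delta : R)
    (n : nat) : Prop :=
  exists (O : {fset answer t}) (A : 'M[domain t]_(n, m) -> fdist R O),
    user_level_DP eps delta A /\
    (forall D : fdist R (domain t), valid D ->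
       2%:R / 3%:R <= success_prob A D).

(* n = n_m(eps, delta); this is relational because no n need exist in general *)
Definition is_user_complexity (R : realType) (t : task R) (m : nat)
    (eps delta : R) (n : nat) : Prop :=
  solvable_with t m eps delta n /\
  (forall n' : nat, solvable_with t m eps delta n' -> (n <= n')%N).

Definition DD (R : realType) (k : nat) (alpha : R) : task R :=
  @Task R 'I_k (fdist R 'I_k)
    (fun _ => True)
    (fun D Q => dTV Q D <= alpha).

Definition DD_rate (R : realType) (k m : nat) (alpha eps : R) : R :=
  k%:R / eps + k%:R / (alpha * eps * Num.sqrt m%:R)
  + k%:R / (alpha ^+ 2 * m%:R).

(* The polylogarithmic factor hidden by Theta-tilde is C * ln (k/(alpha eps))^c
   for absolute constants C and c: it covers the parameters k, 1/alpha and
   1/eps, but not m, so that the bounds are uniform in m. *)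
Definition polylog (R : realType) (C : R) (c k : nat) (alpha eps : R) : R :=
  C * ln (k%:R / (alpha * eps)) ^+ c.

(* Main.v *)
(**
  Lower bound.  Put mass 1/2 on one point and perturb the masses of the other
  h = k - 1 points independently, each by one of 324 multiples of alpha / h.  A
  given answer is alpha-close to at most a 9^-h fraction of these distributions,
  so under the unperturbed distribution U the algorithm is right for a typical
  perturbation D with probability at most 9^-h.  Passing from D to U costs at
  most a factor exp (O (alpha^2 n m)) by Cauchy-Schwarz and the chi-square
  divergence, and at most a factor (1 + d (e^eps - 1))^n by privacy, where
  d = O (min (1, alpha sqrt m)) is the L1 distance between the laws of one user's
  data; a success probability of 2/3 under D therefore forces n to be large.

  Upper bound.  Run the exponential mechanism on a grid of exp (O~ (k))
  candidates Q, with loss max over W of the sum over users of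
  sqrt m (Q W - phat W) clipped to [-T, T], T of order ln (1 / alpha).  Clipping
  biases a user's mean by O (alpha) only, so with gamma = alpha sqrt m <= 1 the
  mean is at most gamma / 4 when Q is close to the truth, and at least
  7 gamma / 8 for some W when Q is alpha-far from it.  Concentration over users
  needs n >= O~ (k / gamma^2), and privacy needs n >= O~ (k / (eps gamma)).
*)
Require Import Defs.
From HB Require Import structures.
From mathcomp Require Import all_boot all_order all_algebra.
From mathcomp Require Import finmap ring lra zify.
From mathcomp Require Import boolp reals sequences exp.
Import Order.TTheory GRing.Theory Num.Theory.
Local Open Scope ring_scope.

Set Implicit Arguments.
Unset Strict Implicit.
Unset Printing Implicit Defensive.

(** * Expectation over independent draws *)

(** [g] takes sequences rather than tuples, so that an induction on [n] can fix the first entry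
    without casts between tuple types. *)
Definition expect (R : realType) (T : finType) (P : T -> R) (n : nat)
    (g : seq T -> R) : R :=
  \sum_(t : n.-tuple T) (\prod_(a <- t) P a) * g t.

Lemma expect0 (R : realType) (T : finType) (P : T -> R) g :
  expect P 0 g = g [::].
Proof.
rewrite /expect (bigD1 [tuple]) //= big_nil mul1r big1 ?addr0 // => t.
by move/eqP; rewrite (tuple0 t).
Qed.

Lemma expectS (R : realType) (T : finType) (P : T -> R) n g :
  expect P n.+1 g = \sum_a P a * expect P n (fun s => g (a :: s)).
Proof.
rewrite /expect.
rewrite (reindex (fun p : T * n.-tuple T => [tuple of p.1 :: p.2])) /=; last first.
  exists (fun t => (thead t, [tuple of behead t])) => [[a t] _|t _].
    by rewrite theadE; congr (_, _); apply/val_inj.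
  by rewrite [RHS]tuple_eta; apply/val_inj.
under [RHS]eq_bigr do rewrite big_distrr.
rewrite pair_big /=; apply: eq_bigr => -[a t] _ /=.
by rewrite big_cons mulrA.
Qed.

Lemma eq_expect (R : realType) (T : finType) (P : T -> R) n f g :
  (forall s, size s = n -> f s = g s) -> expect P n f = expect P n g.
Proof. by move=> fg; apply: eq_bigr => t _; rewrite fg ?size_tuple. Qed.

Lemma ler_expect (R : realType) (T : finType) (P : T -> R) n f g :
  (forall a, 0 <= P a) -> (forall s, size s = n -> f s <= g s) ->
  expect P n f <= expect P n g.
Proof.
move=> P0 fg; apply: ler_sum => t _.
by rewrite ler_wpM2l ?prodr_ge0 ?fg ?size_tuple.
Qed.

Lemma expectD (R : realType) (T : finType) (P : T -> R) n f g :
  expect P n (fun s => f s + g s) = expect P n f + expect P n g.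
Proof. by rewrite -big_split; apply: eq_bigr => t _; rewrite mulrDr. Qed.

Lemma expectZ (R : realType) (T : finType) (P : T -> R) n c f :
  expect P n (fun s => c * f s) = c * expect P n f.
Proof. by rewrite big_distrr; apply: eq_bigr => t _; rewrite mulrCA. Qed.

Lemma expect_sum (R : realType) (T I : finType) (A : pred I) (P : T -> R) n
    (f : I -> seq T -> R) :
  expect P n (fun s => \sum_(i | A i) f i s) = \sum_(i | A i) expect P n (f i).
Proof.
rewrite exchange_big; apply: eq_bigr => t _.
by rewrite big_distrr.
Qed.

Lemma expect_prod (R : realType) (T : finType) (P h : T -> R) n :
  expect P n (fun s => \prod_(a <- s) h a) = (\sum_a P a * h a) ^+ n.
Proof.
elim: n => [|n IH]; first by rewrite expect0 big_nil.
rewrite expectS exprS mulr_suml; apply: eq_bigr => a _.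
under eq_expect do rewrite big_cons.
by rewrite expectZ IH mulrA.
Qed.

Lemma expect_cst (R : realType) (T : finType) (P : T -> R) n c :
  \sum_a P a = 1 -> expect P n (fun=> c) = c.
Proof.
move=> P1; elim: n => [|n IH]; first by rewrite expect0.
by rewrite expectS; under eq_bigr do rewrite IH; rewrite -mulr_suml P1 mul1r.
Qed.

(** Marginalisation of the trailing entries; it lets a user discard surplus examples. *)
Lemma expect_take (R : realType) (T : finType) (P : T -> R) n n' g :
  \sum_a P a = 1 -> (n' <= n)%N ->
  expect P n (fun s => g (take n' s)) = expect P n' g.
Proof.
move=> P1; elim: n' n g => [|n' IH] [|n] g //= n'n.
- by rewrite !expect0.
- rewrite expect0 -[RHS](expect_cst n.+1 (g [::]) P1).
  by apply: eq_expect => s _; rewrite take0.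
- rewrite !expectS; apply: eq_bigr => a _; congr (_ * _).
  by rewrite -(IH n (fun s => g (a :: s))).
Qed.

(** * Data matrices as tuples of users *)

Definition row_prob (R : realType) (Z : finType) m (D : Z -> R)
    (r : m.-tuple Z) : R := \prod_(z <- r) D z.

Lemma row_prob_ge0 (R : realType) (Z : finType) m (D : Z -> R)
    (r : m.-tuple Z) : (forall z, 0 <= D z) -> 0 <= row_prob D r.
Proof. by move=> D0; apply: prodr_ge0. Qed.

Lemma sum_row_prob (R : realType) (Z : finType) m (D : Z -> R) :
  \sum_z D z = 1 -> \sum_(r : m.-tuple Z) row_prob D r = 1.
Proof.
move=> D1; rewrite -(expect_cst m 1 D1).
by apply: eq_bigr => r _; rewrite mulr1.
Qed.

Lemma fdist_ge0 (R : realType) (T : finType) (P : fdist R T) t : 0 <= P t.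
Proof. by case: P => f /= /andP[/forallP]. Qed.

Lemma fdist_sum1 (R : realType) (T : finType) (P : fdist R T) : \sum_t P t = 1.
Proof. by case: P => f /= /andP[_ /eqP]. Qed.

Definition rows (Z : Type) n m (x : 'M[Z]_(n, m)) : n.-tuple (m.-tuple Z) :=
  [tuple [tuple x i j | j < m] | i < n].

Definition mx_of_rows (Z : Type) n m (t : n.-tuple (m.-tuple Z)) : 'M[Z]_(n, m) :=
  \matrix_(i, j) tnth (tnth t i) j.

Lemma rowsK (Z : Type) n m : cancel (@rows Z n m) (@mx_of_rows Z n m).
Proof. by move=> x; apply/matrixP => i j; rewrite mxE !tnth_mktuple. Qed.

Lemma mx_of_rowsK (Z : Type) n m : cancel (@mx_of_rows Z n m) (@rows Z n m).
Proof.
move=> t; apply: eq_from_tnth => i; apply: eq_from_tnth => j.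
by rewrite !tnth_mktuple mxE.
Qed.

(** Turns users into the letters of a product measure: one row is one draw from [row_prob D]. *)
Lemma sum_iid_prob (R : realType) (Z : finType) n m (D : fdist R Z)
    (g : 'M[Z]_(n, m) -> R) :
  \sum_x iid_prob D x * g x =
  \sum_(t : n.-tuple (m.-tuple Z)) (\prod_(r <- t) row_prob D r) * g (mx_of_rows t).
Proof.
rewrite (reindex (@mx_of_rows Z n m)) /=; last first.
  by exists (@rows Z n m) => x _; rewrite ?rowsK ?mx_of_rowsK.
apply: eq_bigr => t _; congr (_ * _).
rewrite big_tuple; apply: eq_bigr => i _.
rewrite /row_prob big_tuple; apply: eq_bigr => j _.
by rewrite mxE.
Qed.

(** * Elementary inequalities and the chi-square divergence *)

(** Lagrange's identity: twice the gap is the double sum of the squares of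
    [a i * b j - a j * b i]. *)
Lemma CauchySchwarz_sum (R : realType) (I : finType) (a b : I -> R) :
  (\sum_i a i * b i) ^+ 2 <= (\sum_i a i ^+ 2) * (\sum_i b i ^+ 2).
Proof.
have H : 0 <= \sum_i \sum_j (a i * b j - a j * b i) ^+ 2.
  by apply: sumr_ge0 => i _; apply: sumr_ge0 => j _; exact: sqr_ge0.
have E0 i j : (a i * b j - a j * b i) ^+ 2 = a i ^+ 2 * b j ^+ 2 +
    (a j ^+ 2 * b i ^+ 2 - 2 * (a i * b i * (a j * b j))) by ring.
have E : \sum_i \sum_j (a i * b j - a j * b i) ^+ 2 =
  2 * ((\sum_i a i ^+ 2) * (\sum_i b i ^+ 2) - (\sum_i a i * b i) ^+ 2).
  transitivity (\sum_i (a i ^+ 2 * (\sum_j b j ^+ 2) +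
     ((\sum_j a j ^+ 2) * b i ^+ 2 - 2 * (a i * b i) * (\sum_j a j * b j)))).
    apply: eq_bigr => i _; under eq_bigr do rewrite E0.
    rewrite big_split sumrB /= -mulr_sumr -mulr_suml -!mulr_sumr; ring.
  rewrite big_split sumrB /= -!mulr_suml -!mulr_sumr; ring.
by move: H; rewrite E pmulr_rge0 // subr_ge0.
Qed.

(** Since [expR (- t) >= 1 - t], it suffices that [(1 + t + 2 * t ^+ 2) * (1 - t) = 1 + t ^+ 2 * (1
    - 2 * t)] is at least 1. *)
Lemma expR_le1DxD2sqr (R : realType) (t : R) :
  t <= 2^-1 -> expR t <= 1 + t + 2 * t ^+ 2.
Proof.
move=> t2; have tN1 : 0 < 1 - t by lra.
have H : expR t * (1 - t) <= 1.
  rewrite -[leRHS](expRxMexpNx_1 t) ler_pM2l ?expR_gt0 //.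
  exact: expR_ge1Dx.
rewrite -(ler_pM2r tN1); apply: (le_trans H).
have : 0 <= t ^+ 2 * (1 - 2 * t) by rewrite mulr_ge0 ?sqr_ge0 //; lra.
lra.
Qed.

Lemma expR1_le4 (R : realType) : expR 1 <= 4 :> R.
Proof.
have H : expR 2^-1 <= 2 :> R.
  by apply: (le_trans (expR_le1DxD2sqr _)); lra.
rewrite (_ : 1 = 2^-1 + 2^-1 :> R) ?expRD; last by field.
have := expR_ge0 (2^-1 : R); nra.
Qed.

Lemma weighted_CauchySchwarz (R : realType) (I : finType) (U a b : I -> R) :
  (forall i, 0 < U i) ->
  (\sum_i a i * b i) ^+ 2 <= (\sum_i a i ^+ 2 / U i) * (\sum_i U i * b i ^+ 2).
Proof.
move=> U0.
have := CauchySchwarz_sum (fun i => a i / Num.sqrt (U i))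
  (fun i => Num.sqrt (U i) * b i).
under eq_bigr => i _ do
  rewrite -mulrA mulKf ?sqrtr_eq0 -?ltNge //.
under [X in _ <= X * _]eq_bigr => i _ do
  rewrite exprMn exprVn sqr_sqrtr ?(ltW (U0 _)) //.
by under [X in _ <= _ * X]eq_bigr => i _ do
  rewrite exprMn sqr_sqrtr ?(ltW (U0 _)) //.
Qed.

(** For distributions, these sums are one plus a chi-square divergence, which is multiplicative over
    independent draws. *)
Lemma chi2_tuple (R : realType) (T : finType) (P U : T -> R) n :
  \sum_(t : n.-tuple T) (\prod_(a <- t) P a) ^+ 2 / (\prod_(a <- t) U a) =
  (\sum_a P a ^+ 2 / U a) ^+ n.
Proof.
rewrite -expect_prod; apply: eq_bigr => t _.
by rewrite prodfV prodrXl.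
Qed.

(** Cauchy-Schwarz with weight [U]: the right-hand side is the sum of [(P a - U a) ^+ 2 / U a]. *)
Lemma sqr_l1_le_chi2 (R : realType) (T : finType) (P U : T -> R) :
  (forall a, 0 < U a) -> \sum_a P a = 1 -> \sum_a U a = 1 ->
  (\sum_a `|P a - U a|) ^+ 2 <= \sum_a P a ^+ 2 / U a - 1.
Proof.
move=> U0 P1 U1.
have := weighted_CauchySchwarz (fun a => `|P a - U a|) (fun=> 1) U0.
under eq_bigr do rewrite mulr1.
move/le_trans; apply.
under [X in _ * X <= _]eq_bigr do rewrite expr1n mulr1.
rewrite U1 mulr1 (_ : \sum_i _ = \sum_i (P i ^+ 2 / U i - (2 * P i - U i))).
  rewrite sumrB sumrB -mulr_sumr U1 P1; lra.
apply: eq_bigr => i _; rewrite real_normK ?num_real //.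
have : U i != 0 by rewrite gt_eqF.
move=> ?; field => //.
Qed.

Lemma l1_le2 (R : realType) (T : finType) (P U : T -> R) :
  (forall a, 0 <= P a) -> (forall a, 0 <= U a) ->
  \sum_a P a = 1 -> \sum_a U a = 1 -> \sum_a `|P a - U a| <= 2.
Proof.
move=> P0 U0 P1 U1; rewrite (_ : 2 = \sum_a (P a + U a)); last first.
  by rewrite big_split /= P1 U1.
apply: ler_sum => a _; apply: (le_trans (ler_normB _ _)).
by rewrite !ger0_norm.
Qed.

(** * Change of measure under privacy *)

(** Centre [G] at its mean [mu] under [U]. The ratio bound keeps [G] within [(c - 1) * mu] of [mu],
    so changing the law moves the expectation by at most [d * (c - 1) * mu]. *)
Lemma private_one_user (R : realType) (T : finType) (P U G : T -> R) (c d : R) :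
  (forall a, 0 <= P a) -> (forall a, 0 <= U a) ->
  \sum_a P a = 1 -> \sum_a U a = 1 -> 1 <= c -> \sum_a `|P a - U a| <= d ->
  (forall a, 0 <= G a) -> (forall a b, G a <= c * G b) ->
  \sum_a P a * G a <= (1 + d * (c - 1)) * \sum_a U a * G a.
Proof.
move=> P0 U0 P1 U1 c1 dE G0 Gc.
set mu := \sum_a U a * G a.
have mu0 : 0 <= mu by apply: sumr_ge0 => a _; rewrite mulr_ge0.
have up a : G a <= c * mu.
  rewrite /mu mulr_sumr -[leLHS]mul1r -U1 mulr_suml; apply: ler_sum => b _.
  by rewrite mulrCA ler_wpM2l.
have lo a : mu <= c * G a.
  rewrite -[leRHS]mul1r -U1 mulr_suml; apply: ler_sum => b _.
  by rewrite ler_wpM2l.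
have dev a : `|G a - mu| <= (c - 1) * mu.
  rewrite ler_norml; have := up a; have := lo a; have := G0 a.
  move=> g0 l1 u1; apply/andP; split; last by lra.
  have : (c - 1) * G a <= (c - 1) * (c * mu) by rewrite ler_wpM2l // subr_ge0.
  case: (leP mu (G a)) => [h|h]; first by have : 0 <= (c - 1) * mu;
    [rewrite mulr_ge0 // subr_ge0|lra].
  have : (c - 1) * G a <= (c - 1) * mu; last by lra.
  by apply: ler_wpM2l; rewrite ?subr_ge0 // ltW.
have -> : \sum_a P a * G a = mu + \sum_a (P a - U a) * (G a - mu).
  under [X in _ = _ + X]eq_bigr do rewrite mulrBl !mulrBr.
  rewrite !sumrB -!mulr_suml P1 U1 -/mu; ring.
rewrite mulrDl mul1r lerD2l -mulrA.
apply: (@le_trans _ _ ((\sum_a `|P a - U a|) * ((c - 1) * mu))).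
  rewrite mulr_suml; apply: ler_sum => a _.
  by apply: (le_trans (ler_norm _)); rewrite normrM ler_wpM2l.
by rewrite ler_wpM2r // mulr_ge0 // subr_ge0.
Qed.

(** Hybrid argument: users are switched from [P] to [U] one at a time, each at the price of one
    factor. *)
Lemma private_expect (R : realType) (T : finType) (P U : T -> R) (c d : R) n
    (g : seq T -> R) :
  (forall a, 0 <= P a) -> (forall a, 0 <= U a) ->
  \sum_a P a = 1 -> \sum_a U a = 1 -> 1 <= c -> \sum_a `|P a - U a| <= d ->
  (forall s, 0 <= g s) ->
  (forall s1 a b s2, (size s1 + size s2).+1 = n ->
     g (s1 ++ a :: s2) <= c * g (s1 ++ b :: s2)) ->
  expect P n g <= (1 + d * (c - 1)) ^+ n * expect U n g.
Proof.
move=> P0 U0 P1 U1 c1 dE.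
have d0 : 0 <= d by apply: le_trans dE; apply: sumr_ge0.
have f0 : 0 <= 1 + d * (c - 1) by rewrite addr_ge0 // mulr_ge0 // subr_ge0.
elim: n g => [|n IH] g g0 gc; first by rewrite !expect0 expr0 mul1r.
have IHa a : expect P n (fun s => g (a :: s)) <=
    (1 + d * (c - 1)) ^+ n * expect U n (fun s => g (a :: s)).
  apply: IH => // s1 b b' s2 sz.
  by have := gc (a :: s1) b b' s2; apply => /=; rewrite addSn sz.
rewrite !expectS.
apply: (@le_trans _ _ ((1 + d * (c - 1)) ^+ n *
    \sum_a P a * expect U n (fun s => g (a :: s)))).
  rewrite mulr_sumr; apply: ler_sum => a _.
  by rewrite mulrCA ler_wpM2l.
rewrite exprSr -mulrA ler_wpM2l ?exprn_ge0 //.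
apply: private_one_user => // [a|a b].
  rewrite -(expect_cst n 0 U1); exact: ler_expect.
rewrite -expectZ; apply: ler_expect => // s sz.
by have := gc [::] a b s; apply; rewrite /= add0n sz.
Qed.

(** * The hard family and its packing count *)

(* The first coordinate carries mass 1/2, so that the other [h] coordinates can
   be perturbed independently of one another. *)
Definition perturbed (R : realType) h (e : 'I_h -> R) : {ffun 'I_h.+1 -> R} :=
  [ffun i => if unlift ord0 i is Some j then (1 + e j) / (2 * h%:R)
             else 2^-1 - (\sum_j e j) / (2 * h%:R)].

Lemma perturbed_ord0 (R : realType) h (e : 'I_h -> R) :
  perturbed e ord0 = 2^-1 - (\sum_j e j) / (2 * h%:R).
Proof. by rewrite /perturbed ffunE unlift_none. Qed.

Lemma perturbed_lift (R : realType) h (e : 'I_h -> R) j :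
  perturbed e (lift ord0 j) = (1 + e j) / (2 * h%:R).
Proof. by rewrite /perturbed ffunE liftK. Qed.

Lemma perturbed_fdist (R : realType) h (e : 'I_h -> R) :
  (0 < h)%N -> (forall j, 0 <= e j <= 1) -> is_fdist (perturbed e).
Proof.
move=> h0 e01; have hR : 0 < h%:R :> R by rewrite ltr0n.
have h2 : h%:R != 0 :> R by rewrite gt_eqF.
apply/andP; split.
  apply/forallP => i; case: (unliftP ord0 i) => [j|] ->; rewrite ?perturbed_ord0 ?perturbed_lift.
    by have /andP[? _] := e01 j; rewrite divr_ge0 ?addr_ge0 ?mulr_ge0 ?ler0n.
  rewrite subr_ge0 ler_pdivrMr ?mulr_gt0 // mulrA mulVf ?mul1r ?pnatr_eq0 //.
  rewrite -[leRHS]mulr1 mulr_natl -[h in _ *+ h]card_ord -sumr_const.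
  by apply: ler_sum => j _; case/andP: (e01 j).
rewrite big_ord_recl perturbed_ord0.
rewrite [X in _ + X](eq_bigr (fun j => (1 + e j) / (2 * h%:R))) => [|j _]; last first.
  exact: perturbed_lift.
rewrite -mulr_suml big_split /= sumr_const card_ord.
apply/eqP; field => //.
Qed.

(** The first point absorbs the total perturbation, so the linear terms cancel. What remains is half
    the squared mean of [e] plus half its mean square, each at most [w ^+ 2 / 2]. *)
Lemma chi2_perturbed (R : realType) h (e : 'I_h -> R) (w : R) :
  (0 < h)%N -> (forall j, 0 <= e j <= w) ->
  \sum_i perturbed e i ^+ 2 / perturbed (fun=> 0) i <= 1 + w ^+ 2.
Proof.
move=> h0 ew; have hR : 0 < h%:R :> R by rewrite ltr0n.
have h2 : h%:R != 0 :> R by rewrite gt_eqF.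
rewrite big_ord_recl !perturbed_ord0 [\sum_(j < h) 0]big1 // mul0r subr0.
rewrite [X in _ + X](eq_bigr (fun j => (2 * h%:R)^-1 * (1 + 2 * e j + e j ^+ 2)))
  => [|j _]; last by rewrite !perturbed_lift; field.
rewrite -mulr_sumr !big_split /= sumr_const card_ord -mulr_sumr.
set S := \sum_j e j; set Q := \sum_j e j ^+ 2.
have S0 : 0 <= S by apply: sumr_ge0 => j _; case/andP: (ew j).
have Sw : S <= h%:R * w.
  rewrite mulr_natl -[h in _ *+ h]card_ord -sumr_const.
  by apply: ler_sum => j _; case/andP: (ew j).
have Qw : Q <= h%:R * w ^+ 2.
  rewrite mulr_natl -[h in _ *+ h]card_ord -sumr_const.
  apply: ler_sum => j _; case/andP: (ew j) => ? ?.
  by rewrite lerXn2r ?nnegrE //; apply: le_trans; eassumption.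
rewrite (_ : _ + _ = 1 + (S / h%:R) ^+ 2 / 2 + (Q / h%:R) / 2); last by field.
have S1 : 0 <= S / h%:R by rewrite divr_ge0 // ltW.
have S2 : S / h%:R <= w by rewrite ler_pdivrMr // mulrC.
have Q2 : Q / h%:R <= w ^+ 2 by rewrite ler_pdivrMr // mulrC.
have S3 : (S / h%:R) ^+ 2 <= w ^+ 2.
  by rewrite lerXn2r ?nnegrE //; apply: le_trans S2.
lra.
Qed.

(* Give letter [s] at position [j] the weight 324 = 18^2 when it approximates
   [q j] and 1 otherwise: words close to [q] match it at half of the positions
   at least, hence have weight at least [18 ^ h], while the total weight of all
   words factorizes. *)
Lemma card_close_words (R : realType) h (q : 'I_h -> R) (c t : R) :
  0 < t ->
  (#|[set s : {ffun 'I_h -> 'I_324} |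
      (\sum_j `|q j - (c + t * (s j)%:R)| <= h%:R * t / 4)%R]| <= 36 ^ h)%N.
Proof.
move=> t0.
pose hit j (l : 'I_324) := `|q j - (c + t * l%:R)| < t / 2.
pose w j l := if hit j l then 324%N else 1%N.
have hit_uniq j l l' : hit j l -> hit j l' -> l = l'.
  wlog ll' : l l' / (l <= l')%N.
    move=> H hl hl'; case: (leqP l l') => [|/ltnW] ll'; first exact: H.
    by apply/esym/H.
  rewrite /hit => /ltr_normlP[a1 a2] /ltr_normlP[b1 b2].
  apply/val_inj/eqP; rewrite /= eqn_leq ll' /= leqNgt; apply/negP => lt.
  have : t * (l%:R + 1) <= t * l'%:R by rewrite ler_pM2l // natr1 ler_nat.
  by rewrite mulrDr mulr1; lra.
(* At most one letter weighs 324 and the others weigh 1, which gives at most 647; 648 is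
   [18 * 36]. *)
have sumw j : (\sum_l w j l <= 648)%N.
  have -> : (\sum_l w j l = #|[pred l | hit j l]| * 323 + 324)%N.
    rewrite (eq_bigr (fun l => (hit j l * 323 + 1)%N)) => [|l _]; last first.
      by rewrite /w; case: (hit j l).
    rewrite big_split /= -big_distrl /= sum1_card card_ord; congr (_ * _ + _)%N.
    by rewrite -sum1_card [RHS]big_mkcond; apply: eq_bigr => l _; rewrite inE; case: (hit j l).
  have : (#|[pred l | hit j l]| <= 1)%N.
    by apply/card_le1P => l; rewrite inE => hl l'; rewrite !inE;
      apply/idP/eqP => [/(hit_uniq _ _ _ hl) ->|->].
  by case: #|_| => [|[|]].
have heavy (s : {ffun 'I_h -> 'I_324}) : \sum_j `|q j - (c + t * (s j)%:R)| <= h%:R * t / 4 ->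
    (18 ^ h <= \prod_j w j (s j))%N.
  move=> sq.
  pose a := #|[pred j | hit j (s j)]|; pose b := #|[pred j | ~~ hit j (s j)]|.
  have ab : (a + b = h)%N.
    by rewrite -[RHS]card_ord -(cardC [pred j | hit j (s j)]).
  (* Each miss costs at least [t / 2], so a total error of [h * t / 4] allows misses at no more than
     half of the positions. *)
  have b2 : (b * 2 <= h)%N.
    rewrite -(ler_nat R) natrM.
    have : b%:R * (t / 2) <= h%:R * t / 4.
      apply: le_trans sq.
      rewrite /b -sum1_card natr_sum mulr_suml big_mkcond /=.
      apply: ler_sum => j _; rewrite inE /hit -leNgt mul1r.
      by case: ifP => // _; exact: normr_ge0.
    rewrite -(ler_pM2r t0); lra.
  have -> : (\prod_j w j (s j) = 324 ^ a)%N.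
    rewrite /a -prod_nat_const [RHS]big_mkcond; apply: eq_bigr => j _.
    by rewrite /w inE.
  rewrite (_ : 324%N = (18 ^ 2)%N) // -expnM leq_exp2l //.
  by move: ab b2; clearbody a b; clear; lia.
(* Markov's inequality for the weights, whose total is at most [648 ^ h]. *)
rewrite -(@leq_pmul2r (18 ^ h)) ?expn_gt0 // -expnMn.
apply: (@leq_trans (\prod_(j < h) \sum_l w j l)); last first.
  rewrite -[h in (_ ^ h)%N]card_ord -prod_nat_const.
  exact: leq_prod.
rewrite bigA_distr_bigA /= -sum_nat_const big_mkcond /=.
apply: leq_sum => s _; rewrite inE; case: ifP => // /heavy.
exact.
Qed.

(** * The lower bound *)

Lemma Pr_ge0 (R : realType) (T : finType) (P : fdist R T) S : 0 <= Pr P S.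
Proof. by apply: sumr_ge0 => t _; exact: fdist_ge0. Qed.

Lemma Pr_le1 (R : realType) (T : finType) (P : fdist R T) S : Pr P S <= 1.
Proof.
rewrite -(fdist_sum1 P) /Pr big_mkcond; apply: ler_sum => t _.
by case: ifP => // _; exact: fdist_ge0.
Qed.

(** If [w ^+ 2 * m%:R <= 2^-1], the chi-square bound on the squared distance is
    [expR (w ^+ 2 * m%:R) - 1], at most [2 * w ^+ 2 * m%:R]; otherwise the trivial bound 2
    suffices. *)
Lemma row_prob_l1 (R : realType) (Z : finType) m (P U : Z -> R) (w : R) :
  (forall z, 0 <= P z) -> (forall z, 0 < U z) ->
  \sum_z P z = 1 -> \sum_z U z = 1 -> 0 <= w ->
  \sum_z P z ^+ 2 / U z <= 1 + w ^+ 2 ->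
  \sum_(r : m.-tuple Z) `|row_prob P r - row_prob U r| <=
    3 * (w * Num.sqrt m%:R).
Proof.
move=> P0 U0 P1 U1 w0 chi.
have rU0 (r : m.-tuple Z) : 0 < row_prob U r by apply: prodr_gt0.
set d := \sum_r _.
have d0 : 0 <= d by apply: sumr_ge0.
have d2 : d <= 2.
  by apply: l1_le2; rewrite ?sum_row_prob // => r; apply: row_prob_ge0 => // z;
    exact: ltW.
have m0 : 0 <= m%:R :> R by [].
rewrite -(@ler_pXn2r _ 2) ?nnegrE // ?mulr_ge0 ?sqrtr_ge0 //.
rewrite !exprMn sqr_sqrtr //.
case: (leP (w ^+ 2 * m%:R) 2^-1) => [small|big].
  have : d ^+ 2 <= expR (w ^+ 2 * m%:R) - 1.
    have := sqr_l1_le_chi2 rU0 (sum_row_prob m P1) (sum_row_prob m U1).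
    rewrite chi2_tuple => /le_trans; apply; rewrite lerD2r.
    rewrite mulrC expRM_natl; apply: lerXn2r; rewrite ?nnegrE ?expR_ge0 //.
      by apply: sumr_ge0 => z _; rewrite divr_ge0 ?sqr_ge0 // ltW.
    by apply: (le_trans chi); exact: expR_ge1Dx.
  have := expR_le1DxD2sqr small.
  have : 0 <= w ^+ 2 * m%:R by rewrite mulr_ge0 ?sqr_ge0.
  nra.
nra.
Qed.

Lemma DD_lower_bound (R : realType) h m n (alpha eps : R) :
  (0 < h)%N -> 0 < alpha <= 5184^-1 -> 0 < eps <= 2^-1 ->
  solvable_with (DD h.+1 alpha) m eps 0 n ->
  [/\ h%:R <= (5184 * alpha) ^+ 2 * m%:R * n%:R,
      h%:R <= 4 * eps * n%:R &
      h%:R <= 6 * (5184 * alpha * Num.sqrt m%:R) * eps * n%:R].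
Proof.
move=> h0 /andP[a0 a1] /andP[e0 e1] [O [A [dp succ]]].
have hR : 0 < h%:R :> R by rewrite ltr0n.
have h2 : h%:R != 0 :> R by rewrite gt_eqF.
set w := 5184 * alpha.
have w0 : 0 <= w by rewrite mulr_ge0 // ltW.
have w1 : w <= 1 by rewrite /w; lra.
(* Neighbouring letters give masses [t = 8 * alpha / h] apart, so that [h * t / 4] is [2 * alpha],
   the L1 budget of an [alpha]-close answer. Perturbations stay below [16 * 324 * alpha = w]. *)
pose e (s : {ffun 'I_h -> 'I_324}) j := 16 * alpha * (s j)%:R.
have ew s j : 0 <= e s j <= w.
  rewrite /e !mulr_ge0 ?(ltW a0) //= /w.
  rewrite -mulrA [leRHS](_ : _ = 16 * (alpha * 324)); last by ring.
  by rewrite ler_pM2l // ler_pM2l // ler_nat ltnW.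
have e01 s j : 0 <= e s j <= 1.
  by have /andP[-> /le_trans->] := ew s j.
have z01 : 0 <= (0 : R) <= 1 by rewrite lexx ler01.
pose D s : fdist R 'I_h.+1 := FDist (perturbed_fdist h0 (e01 s)).
pose U : fdist R 'I_h.+1 := FDist (perturbed_fdist h0 (fun=> z01)).
have U0 z : 0 < U z.
  rewrite /U /=; case: (unliftP ord0 z) => [j|] ->.
    by rewrite perturbed_lift addr0 mul1r invr_gt0 mulr_gt0.
  by rewrite perturbed_ord0 big1 // mul0r subr0 invr_gt0.
have chi s : \sum_z D s z ^+ 2 / U z <= 1 + w ^+ 2 by exact: chi2_perturbed.
pose G s x := Pr (A x) [set o : O | @correct _ (DD h.+1 alpha) (D s) (val o)].
have GE s : 2%:R / 3%:R <= \sum_(t : n.-tuple (m.-tuple 'I_h.+1))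
    (\prod_(r <- t) row_prob (D s) r) * G s (mx_of_rows t).
  by rewrite -sum_iid_prob; exact: succ.
pose EU s := \sum_(t : n.-tuple (m.-tuple 'I_h.+1))
    (\prod_(r <- t) row_prob U r) * G s (mx_of_rows t).
(* Double counting: whatever the data, each answer is correct for at most [36 ^ h] words. *)
have sumEU : \sum_s EU s <= 36 ^+ h.
  rewrite exchange_big /=.
  have U1 := sum_row_prob m (fdist_sum1 U).
  rewrite -(expect_cst n (36 ^+ h) U1); apply: ler_sum => t _.
  rewrite -mulr_sumr ler_wpM2l ?prodr_ge0 // => [r _|].
    by apply: row_prob_ge0 => z; exact: (fdist_ge0 U).
  rewrite /G /Pr; under eq_bigr do rewrite big_mkcond.
  rewrite exchange_big; set x := mx_of_rows t.
  rewrite (_ : 36 ^+ h = \sum_o A x o * 36 ^+ h); last first.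
    by rewrite -mulr_suml fdist_sum1 mul1r.
  apply: ler_sum => o _.
  rewrite -big_mkcond sumr_const -[leLHS]mulr_natr.
  rewrite ler_wpM2l ?fdist_ge0 // -natrX ler_nat.
  have t0 : 0 < 16 * alpha / (2 * h%:R) by rewrite divr_gt0 ?mulr_gt0.
  have := card_close_words (fun j => val o (lift ord0 j)) (2 * h%:R)^-1 t0.
  apply: leq_trans; apply: subset_leq_card; apply/subsetP => s.
  rewrite inE unfold_in.
  rewrite -[X in is_true X -> _]/(o \in
    [set o0 : O | @correct _ (DD h.+1 alpha) (D s) (val o0)]).
  rewrite inE /= /dTV => close.
  apply: (@le_trans _ _ (2 * alpha)); last first.
    by rewrite (_ : _ / 4 = 2 * alpha) //; field.
  rewrite -ler_pdivrMl //; apply: le_trans close; rewrite ler_pM2l ?invr_gt0 //.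
  rewrite [leRHS]big_ord_recl ler_wpDl //; apply: ler_sum => j _.
  rewrite perturbed_lift /e le_eqVlt; apply/orP; left; apply/eqP.
  by congr `|_ - _|; field.
(* [K] is the price of moving from [D s] to [U]. Averaging over the [324 ^ h] words gives
   [9 ^ h * c <= K]; as [expR 1 <= 4 <= 9 * c], one of the [h] factors 9 absorbs [c]. *)
have avg (c K : R) : 0 <= K -> 4 / 9 <= c -> (forall s, c <= K * EU s) -> expR h%:R <= K.
  move=> K0 c49 cK.
  have H : 324 ^+ h * c <= K * 36 ^+ h.
    apply: (@le_trans _ _ (K * \sum_s EU s)); last by rewrite ler_wpM2l.
    rewrite mulr_sumr.
    have -> : 324 ^+ h * c = \sum_(s : {ffun 'I_h -> 'I_324}) c.
      by rewrite sumr_const card_ffun !card_ord -natrX mulr_natl.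
    by apply: ler_sum => s _; exact: cK.
  have {}H : 9 ^+ h * c <= K.
    rewrite -(@ler_pM2r _ (36 ^+ h)) ?exprn_gt0 //.
    by rewrite mulrAC -exprMn (_ : 9 * 36 = 324 :> R) //; ring.
  apply: le_trans H.
  rewrite -[X in expR X]mulr1 expRM_natl -(prednK h0) !exprS.
  have : expR 1 ^+ h.-1 <= 9 ^+ h.-1 :> R.
    apply: lerXn2r; rewrite ?nnegrE ?expR_ge0 //.
    by apply: (le_trans (expR1_le4 R)); rewrite ler_nat.
  have := expR1_le4 R; have := expR_ge0 (1 : R).
  have : 0 <= expR 1 ^+ h.-1 :> R by rewrite exprn_ge0 ?expR_ge0.
  set x := expR 1; set y := x ^+ _; set z := 9 ^+ _ => y0 x0 x4 yz.
  apply: (@le_trans _ _ (4 * z)); first by apply: ler_pM.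
  rewrite [leRHS](_ : _ = (9 * c) * z); last by ring.
  by rewrite ler_wpM2r //; clear - c49 y0 yz; lra.
(* Applied twice: with the trivial distance 2, and with the bound of order [w * sqrt m]. *)
have privacy (d : R) : (forall s, \sum_(r : m.-tuple 'I_h.+1)
    `|row_prob (D s) r - row_prob U r| <= d) -> h%:R <= 2 * d * eps * n%:R.
  move=> dE.
  have d0 : 0 <= d.
    by apply: le_trans (dE [ffun=> ord0]); apply: sumr_ge0.
  have ee : expR eps - 1 <= 2 * eps.
    have := expR_le1DxD2sqr e1; clear - e0 e1; nra.
  have ee0 : 1 <= expR eps by rewrite -expR0 ler_expR ltW.
  have : expR h%:R <= (1 + d * (expR eps - 1)) ^+ n.
    apply: (avg (2 / 3)) => [||s]; [|clear; lra|].
      by rewrite exprn_ge0 // addr_ge0 // mulr_ge0 // subr_ge0.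
    (* A padding value, never read on sequences of length [n]. *)
    pose r0 : m.-tuple 'I_h.+1 := nseq_tuple m ord0.
    pose g t := G s (\matrix_(i, j) tnth (nth r0 t i) j).
    have gE (D' : 'I_h.+1 -> R) : expect (@row_prob _ _ m D') n g =
      \sum_(t : n.-tuple (m.-tuple 'I_h.+1))
         (\prod_(r <- t) row_prob D' r) * G s (mx_of_rows t).
      apply: eq_bigr => t _; congr (_ * G s _); apply/matrixP => i j.
      by rewrite !mxE -tnth_nth.
    apply: (le_trans (GE s)); rewrite /EU -!gE.
    apply: private_expect => //.
    - by move=> r; apply: row_prob_ge0; exact: fdist_ge0.
    - by move=> r; apply: row_prob_ge0; exact: (fdist_ge0 U).
    - by rewrite sum_row_prob ?fdist_sum1.
    - by rewrite sum_row_prob ?(fdist_sum1 U).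
    - by move=> t; exact: Pr_ge0.
    move=> s1 a b s2 sz; rewrite /g /G.
    set S := [set _ | _]; rewrite -[leRHS]addr0; apply: dp.
    have s1n : (size s1 < n)%N by rewrite -sz ltnS leq_addr.
    exists (Ordinal s1n) => i in1; apply/rowP => j; rewrite !mxE !nth_cat.
    case: ltnP => // s1i.
    have {}in1 : nat_of_ord i != size s1 by [].
    case E : (i - size s1)%N => [|l] //.
    by move/eqP: E; rewrite subn_eq0 => is1; rewrite eqn_leq is1 s1i in in1.
  move=> H.
  have {}H : expR h%:R <= expR (n%:R * (d * (expR eps - 1))).
    apply: (le_trans H); rewrite expRM_natl; apply: lerXn2r.
    - by rewrite nnegrE addr_ge0 // mulr_ge0 // subr_ge0.
    - by rewrite nnegrE expR_ge0.
    - exact: expR_ge1Dx.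
  rewrite ler_expR in H; apply: (le_trans H).
  rewrite [leRHS](_ : _ = n%:R * (d * (2 * eps))); last by ring.
  by rewrite ler_wpM2l // ler_wpM2l.
split.
(* Here 4/9 is the square of 2/3: Cauchy-Schwarz bounds the squared success probability by the
   chi-square factor times a second moment under [U], and [G <= 1] turns that into a first
   moment. *)
- have : expR h%:R <= expR (w ^+ 2 * m%:R * n%:R).
    apply: (avg (4 / 9)) => [|//|s]; first exact: expR_ge0.
    have pU (t : n.-tuple (m.-tuple 'I_h.+1)) : 0 < \prod_(r <- t) row_prob U r.
      by apply: prodr_gt0 => r _; apply: prodr_gt0.
    have := weighted_CauchySchwarz
      (fun t : n.-tuple (m.-tuple 'I_h.+1) => \prod_(r <- t) row_prob (D s) r)
      (fun t => G s (mx_of_rows t)) pU.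
    rewrite !chi2_tuple => H.
    have {}H : 4 / 9 <= (\sum_i D s i ^+ 2 / U i) ^+ m ^+ n * EU s.
      have sq : 4 / 9 <= (\sum_(t : n.-tuple (m.-tuple 'I_h.+1))
          (\prod_(r <- t) row_prob (D s) r) * G s (mx_of_rows t)) ^+ 2.
        have := GE s; set X := \sum_t _; clearbody X; clear; nra.
      apply: (le_trans sq); apply: (le_trans H); rewrite ler_wpM2l //.
        do 2!apply: exprn_ge0; apply: sumr_ge0 => z _.
        by rewrite divr_ge0 ?sqr_ge0 ?fdist_ge0.
      apply: ler_sum => t _; rewrite ler_pM2l // expr2.
      by rewrite ler_piMr ?Pr_ge0 ?Pr_le1.
    apply: (le_trans H); rewrite ler_wpM2r //.
      by apply: sumr_ge0 => t _; rewrite mulr_ge0 ?Pr_ge0 // ltW.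
    rewrite -exprM -mulrA -natrM mulrC expRM_natl.
    apply: lerXn2r; rewrite ?nnegrE ?expR_ge0 //.
      by apply: sumr_ge0 => z _; rewrite divr_ge0 ?sqr_ge0 ?fdist_ge0.
    by apply: (le_trans (chi s)); exact: expR_ge1Dx.
  by rewrite ler_expR.
- have -> : 4 * eps * n%:R = 2 * 2 * eps * n%:R by ring.
  apply: privacy => s; apply: l1_le2.
  + by move=> r; apply: row_prob_ge0; exact: fdist_ge0.
  + by move=> r; apply: row_prob_ge0; exact: (fdist_ge0 U).
  + by rewrite sum_row_prob ?fdist_sum1.
  + by rewrite sum_row_prob ?(fdist_sum1 U).
- have -> : 6 * (w * Num.sqrt m%:R) * eps * n%:R =
    2 * (3 * (w * Num.sqrt m%:R)) * eps * n%:R by ring.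
  apply: privacy => s; apply: row_prob_l1 => //.
  + exact: fdist_ge0.
  + exact: fdist_sum1.
  + exact: fdist_sum1.
Qed.

(** * Exponential moments of bounded sums *)

Lemma mgf_bounded (R : realType) (T : finType) (P f : T -> R) (la mu B : R) :
  (forall a, 0 <= P a) -> \sum_a P a = 1 -> (forall a, `|f a| <= B) ->
  0 <= la -> la * B <= 2^-1 -> \sum_a P a * f a <= mu ->
  \sum_a P a * expR (la * f a) <= expR (la * mu + 2 * (la * B) ^+ 2).
Proof.
move=> P0 P1 fB la0 laB mean.
apply: le_trans (expR_ge1Dx _).
apply: (@le_trans _ _ (\sum_a (P a + la * (P a * f a) + P a * (2 * (la * B) ^+ 2)))).
  apply: ler_sum => a _.
  have lf : `|la * f a| <= la * B by rewrite normrM ger0_norm // ler_wpM2l.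
  have lf2 : (la * f a) ^+ 2 <= (la * B) ^+ 2.
    by rewrite -real_normK ?num_real // lerXn2r ?nnegrE //; apply: le_trans lf.
  have le2 : la * f a <= 2^-1.
    by apply: le_trans laB; apply: le_trans lf; exact: ler_norm.
  have := expR_le1DxD2sqr le2.
  move=> H; rewrite [leRHS](_ : _ = P a * (1 + la * f a + 2 * (la * B) ^+ 2)).
    by rewrite ler_wpM2l //; lra.
  by ring.
rewrite !big_split /= -mulr_sumr -mulr_suml P1 mul1r addrA lerD2r lerD2l.
by rewrite ler_wpM2l.
Qed.

(** The moment in Chernoff's bound. Leaving Markov's inequality to the application keeps union
    bounds as plain sums of moments. *)
Lemma expect_expR_sum (R : realType) (T : finType) (P f : T -> R)
    (la mu B b : R) n :
  (forall a, 0 <= P a) -> \sum_a P a = 1 -> (forall a, `|f a| <= B) ->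
  0 <= la -> la * B <= 2^-1 -> \sum_a P a * f a <= mu ->
  expect P n (fun s => expR (la * ((\sum_(a <- s) f a) - n%:R * b))) <=
  expR (n%:R * (la * (mu - b) + 2 * (la * B) ^+ 2)).
Proof.
move=> P0 P1 fB la0 laB mean.
have -> : expect P n (fun s => expR (la * ((\sum_(a <- s) f a) - n%:R * b))) =
    expR (- (n%:R * (la * b))) * expect P n (fun s => \prod_(a <- s) expR (la * f a)).
  rewrite -expectZ; apply: eq_expect => s _.
  rewrite -expR_sum -expRD -mulr_sumr; congr expR; ring.
rewrite expect_prod.
have := mgf_bounded P0 P1 fB la0 laB mean; set X := \sum_a _ => H.
have X0 : 0 <= X by apply: sumr_ge0 => a _; rewrite mulr_ge0 ?expR_ge0.
apply: (@le_trans _ _ (expR (- (n%:R * (la * b))) *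
    expR (la * mu + 2 * (la * B) ^+ 2) ^+ n)).
  by rewrite ler_wpM2l ?expR_ge0 // lerXn2r ?nnegrE ?expR_ge0.
by rewrite -expRM_natl -expRD le_eqVlt; apply/orP; left; apply/eqP; congr expR; ring.
Qed.

(** * Clipped deviations of one user's empirical masses *)

Definition clip (R : realType) (T y : R) : R := Num.max (- T) (Num.min T y).

Lemma clip_norm (R : realType) (T y : R) : 0 <= T -> `|clip T y| <= T.
Proof.
move=> T0; rewrite /clip ler_norml le_max lexx /= ge_max ge_min lexx /= andbT.
lra.
Qed.

Lemma clip_le (R : realType) (T y y' : R) : y <= y' -> clip T y <= clip T y'.
Proof.
move=> yy; rewrite /clip.
by case: (leP T y) => ?; case: (leP T y') => ?; case: (leP (- T) T) => ?;
  case: (leP (- T) y) => ?; case: (leP (- T) y') => ?; lra.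
Qed.

(** The error is the excess of [|y|] over [T], if any, and [x <= 2 * expR (x / 2)]; the exponential
    form can be averaged by moment bounds. *)
Lemma clip_error (R : realType) (T y : R) : 0 <= T ->
  `|clip T y - y| <= 2 * expR ((`|y| - T) / 2).
Proof.
move=> T0.
have H : `|y| - T <= 2 * expR ((`|y| - T) / 2).
  have := expR_ge1Dx ((`|y| - T) / 2); lra.
have := expR_ge0 ((`|y| - T) / 2); rewrite /clip.
have := ler_norm y; have := ler_norm (- y); rewrite normrN => N1 N2 E0.
by case: (leP T y) => ?; case: (leP (- T) T) => ?; case: (leP (- T) y) => ?;
  rewrite ler_norml; lra.
Qed.

Lemma expect_sum_seq (R : realType) (T : finType) (P f : T -> R) n :
  \sum_a P a = 1 ->
  expect P n (fun s => \sum_(a <- s) f a) = n%:R * \sum_a P a * f a.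
Proof.
move=> P1; elim: n => [|n IH]; first by rewrite expect0 big_nil mul0r.
rewrite expectS.
under eq_bigr => a _ do
  (under eq_expect do rewrite big_cons; rewrite expectD expect_cst // IH).
under eq_bigr do rewrite mulrDr.
by rewrite big_split /= -mulr_suml P1 -natr1 mulrDl !mul1r addrC.
Qed.

(* [sqrt m * (q - phat W)], where [phat W] is the fraction of the [m] entries of
   [s] that lie in [W] *)
Definition deviation (R : realType) (Z : finType) (W : {set Z}) (q : R)
    (s : seq Z) : R :=
  (\sum_(z <- s) (q - (z \in W)%:R)) / Num.sqrt (size s)%:R.

Lemma deviation_shift (R : realType) (Z : finType) (W : {set Z}) (q p : R) s :
  deviation W q s = deviation W p s + (q - p) * Num.sqrt (size s)%:R.
Proof.
case: (posnP (size s)) => [s0|s0].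
  by rewrite /deviation s0 sqrtr0 invr0 !mulr0 addr0.
have sq0 : 0 < Num.sqrt (size s)%:R :> R by rewrite sqrtr_gt0 ltr0n.
rewrite /deviation !sumrB !big_const_seq !count_predT !iter_addr_0.
rewrite -[_ *+ size s]mulr_natr -[p *+ _]mulr_natr.
rewrite -{1 3}(sqr_sqrtr (ler0n R (size s))).
have : Num.sqrt (size s)%:R != 0 :> R by rewrite gt_eqF.
by move=> ?; field.
Qed.

Lemma sum_fdist_indic (R : realType) (Z : finType) (D : fdist R Z) (W : {set Z}) :
  \sum_z D z * (Pr D W - (z \in W)%:R) = 0.
Proof.
under eq_bigr do rewrite mulrBr.
rewrite sumrB -mulr_suml fdist_sum1 mul1r /Pr [X in X - _]big_mkcond /=.
by rewrite -sumrB big1 // => z _; case: (z \in W); rewrite ?mulr1 ?mulr0 subrr.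
Qed.

(** [sg] is a sign, to cover both tails. The rate [la = 1 / (2 * sqrt m)] gives [m] centred terms of
    size at most 1 the total exponent [2 * m * la ^+ 2 = 1 / 2]. *)
Lemma mgf_deviation (R : realType) (Z : finType) (D : fdist R Z) (W : {set Z})
    (sg : R) m :
  (0 < m)%N -> sg ^+ 2 = 1 ->
  expect D m (fun s => expR (sg * deviation W (Pr D W) s / 2)) <= 2.
Proof.
move=> m0 sg1.
have sgN : `|sg| = 1.
  by apply/eqP; rewrite -(@eqrXn2 _ 2) ?normr_ge0 // real_normK ?num_real ?sg1 ?expr1n.
have mR : 0 < m%:R :> R by rewrite ltr0n.
have sq0 : 0 < Num.sqrt m%:R :> R by rewrite sqrtr_gt0.
have sq1 : 1 <= Num.sqrt m%:R :> R.
  by rewrite -[leLHS]sqrtr1 ler_wsqrtr // ler1n.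
pose la : R := (2 * Num.sqrt m%:R)^-1.
pose f z := sg * (Pr D W - (z \in W)%:R).
have f1 z : `|f z| <= 1.
  rewrite normrM sgN mul1r.
  have := Pr_ge0 D W; have := Pr_le1 D W => ? ?.
  rewrite ler_norml; case: (z \in W) => /=; lra.
have la0 : 0 <= la by rewrite invr_ge0 mulr_ge0 // ltW.
have la2 : la * 1 <= 2^-1 by rewrite mulr1 lef_pV2 ?posrE ?mulr_gt0 //; lra.
have mean : \sum_z D z * f z <= 0.
  rewrite /f; under eq_bigr do rewrite mulrCA.
  by rewrite -mulr_sumr sum_fdist_indic mulr0.
have := expect_expR_sum 0 m (fdist_ge0 D) (fdist_sum1 D) f1 la0 la2 mean.
set lhs := (X in X <= _ -> _); set lhs' := (X in _ -> X <= _).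
have -> : lhs = lhs'.
  apply: eq_expect => s sz; rewrite mulr0 subr0 /f -mulr_sumr /deviation sz /la.
  congr expR; field; by rewrite gt_eqF.
move/le_trans; apply.
have -> : m%:R * (la * (0 - 0) + 2 * (la * 1) ^+ 2) = 2^-1.
  rewrite /la subr0 mulr0 add0r mulr1 exprVn exprMn sqr_sqrtr ?ltW //.
  by field; rewrite gt_eqF.
by apply: (le_trans (expR_le1DxD2sqr _)); lra.
Qed.

(** The deviation has mean 0, so the bias is the mean clipping error. The 16 is [2 * 2 * (2 + 2)]:
    from [clip_error], from [expR (c / 2) <= 2], and from the two tails. *)
Lemma expect_clip_error (R : realType) (Z : finType) (D : fdist R Z)
    (W : {set Z}) (T c : R) m :
  (0 < m)%N -> 0 <= T -> 0 <= c <= 1 ->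
  `|expect D m (fun s => clip T (deviation W (Pr D W) s + c)) - c| <=
  16 * expR (- T / 2).
Proof.
move=> m0 T0 /andP[c0 c1]; set dev := deviation W (Pr D W).
have mean : expect D m dev = 0.
  have -> : expect D m dev = (Num.sqrt m%:R)^-1 *
      expect D m (fun s => \sum_(z <- s) (Pr D W - (z \in W)%:R)).
    by rewrite -expectZ; apply: eq_expect => s sz; rewrite /dev /deviation sz mulrC.
  by rewrite expect_sum_seq ?fdist_sum1 // sum_fdist_indic !mulr0.
have -> : expect D m (fun s => clip T (dev s + c)) - c =
    expect D m (fun s => clip T (dev s + c) - (dev s + c)).
  have cE : expect D m (fun s => dev s + c) = c.
    by rewrite expectD mean add0r expect_cst // fdist_sum1.
  rewrite -[X in _ - X = _]cE -mulN1r -expectZ -expectD.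
  by apply: eq_expect => s _; rewrite mulN1r.
apply: (@le_trans _ _ (expect D m (fun s => 4 * expR (- T / 2) *
    (expR (1 * dev s / 2) + expR ((- 1) * dev s / 2))))).
  apply: (@le_trans _ _ (expect D m (fun s => `|clip T (dev s + c) - (dev s + c)|))).
    apply: (le_trans (ler_norm_sum _ _ _)); apply: ler_sum => t _.
    by rewrite normrM ger0_norm ?prodr_ge0 // => z _; exact: fdist_ge0.
  apply: ler_expect => [z|s _]; first exact: fdist_ge0.
  apply: (le_trans (clip_error _ T0)).
  have e2 : expR 2^-1 <= 2 :> R.
    by apply: (le_trans (expR_le1DxD2sqr _)); lra.
  have -> : 4 * expR (- T / 2) *
      (expR (1 * dev s / 2) + expR ((- 1) * dev s / 2)) =
    2 * (expR (- T / 2) * 2 * (expR (dev s / 2) + expR (- dev s / 2))).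
    by rewrite mul1r mulN1r; ring.
  rewrite ler_pM2l //.
  apply: (@le_trans _ _ (expR (- T / 2) * expR 2^-1 * expR (`|dev s| / 2))).
    rewrite -!expRD ler_expR.
    have : `|dev s + c| <= `|dev s| + 1.
      by apply: (le_trans (ler_normD _ _)); rewrite lerD2l ger0_norm.
    lra.
  apply: ler_pM; rewrite ?mulr_ge0 ?expR_ge0 //.
    by rewrite ler_wpM2l ?expR_ge0.
  by case: (ler0P (dev s)) => _; rewrite ?lerDl ?lerDr expR_ge0.
rewrite expectZ expectD.
have E1 := mgf_deviation D W m0 (expr1n R 2).
have E2 := mgf_deviation D W m0 (sqrr_sign R 1).
have := expR_ge0 (- T / 2); rewrite -/dev in E1 E2; nra.
Qed.

(** * The exponential mechanism *)

Definition expmech (R : realType) (O : finType) (eta : R) (L : O -> R) :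
    {ffun O -> R} :=
  [ffun o => expR (- (eta * L o)) / \sum_o' expR (- (eta * L o'))].

Lemma expmech_norm_gt0 (R : realType) (O : finType) (o0 : O) (eta : R)
    (L : O -> R) : 0 < \sum_o expR (- (eta * L o)).
Proof.
rewrite (bigD1 o0) //= ltr_wpDr ?expR_gt0 //.
by apply: sumr_ge0 => o _; exact: expR_ge0.
Qed.

Lemma expmech_fdist (R : realType) (O : finType) (o0 : O) (eta : R) (L : O -> R) :
  is_fdist (expmech eta L).
Proof.
have Z0 := expmech_norm_gt0 o0 eta L.
apply/andP; split.
  by apply/forallP => o; rewrite /expmech ffunE divr_ge0 ?expR_ge0 // ltW.
rewrite /expmech; under eq_bigr do rewrite ffunE.
by rewrite -mulr_suml divff // gt_eqF.
Qed.

(** Weight and normaliser each change by a factor of at most [expR (eta * s)], whence the 2. *)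
Lemma expmech_ratio (R : realType) (O : finType) (eta s : R) (L L' : O -> R) o :
  0 <= eta -> (forall o, L o <= L' o + s) -> (forall o, L' o <= L o + s) ->
  expmech eta L o <= expR (2 * eta * s) * expmech eta L' o.
Proof.
move=> eta0 LL' L'L; rewrite /expmech !ffunE.
have Z0 := expmech_norm_gt0 o eta L; have Z0' := expmech_norm_gt0 o eta L'.
have ratio (M M' : O -> R) : (forall o, M' o <= M o + s) ->
    forall o, expR (- (eta * M o)) <= expR (eta * s) * expR (- (eta * M' o)).
  move=> MM' a; rewrite -expRD ler_expR.
  have : eta * M' a <= eta * (M a + s) by rewrite ler_wpM2l.
  lra.
have Z : \sum_o expR (- (eta * L' o)) <=
    expR (eta * s) * \sum_o expR (- (eta * L o)).
  by rewrite mulr_sumr; apply: ler_sum => a _; exact: ratio.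
rewrite ler_pdivrMr //.
apply: (le_trans (ratio _ _ L'L o)).
rewrite (_ : 2 * eta * s = eta * s + eta * s); last by ring.
rewrite expRD [leRHS](_ : _ = expR (eta * s) * expR (- (eta * L' o)) *
  (expR (eta * s) * (\sum_o expR (- (eta * L o))) /
   \sum_o expR (- (eta * L' o)))); last by ring.
by rewrite ler_peMr ?mulr_ge0 ?expR_ge0 // ler_pdivlMr // mul1r.
Qed.

(** The normaliser is at least the weight of the good candidate [o], and a union bound covers the
    bad ones. *)
Lemma expmech_tail (R : realType) (O : finType) (eta a b : R) (L : O -> R)
    (o : O) (S : {set O}) :
  0 <= eta -> L o <= a -> (forall o', o' \in S -> b <= L o') ->
  \sum_(o' in S) expmech eta L o' <= #|O|%:R * expR (- (eta * (b - a))).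
Proof.
move=> eta0 La Lb; have Z0 := expmech_norm_gt0 o eta L.
have Za : expR (- (eta * a)) <= \sum_o expR (- (eta * L o)).
  apply: (@le_trans _ _ (expR (- (eta * L o)))).
    by rewrite ler_expR lerN2 ler_wpM2l.
  by rewrite [leRHS](bigD1 o) //= lerDl; apply: sumr_ge0 => ? _; exact: expR_ge0.
apply: (@le_trans _ _ (\sum_(o' in S) expR (- (eta * (b - a))))).
  apply: ler_sum => o' oS; rewrite /expmech ffunE ler_pdivrMr //.
  apply: (@le_trans _ _ (expR (- (eta * (b - a))) * expR (- (eta * a)))).
    by rewrite -expRD ler_expR -opprD lerN2 -mulrDr subrK ler_wpM2l // Lb.
  by rewrite ler_wpM2l ?expR_ge0.
rewrite sumr_const -[leLHS]mulr_natl ler_wpM2r ?expR_ge0 // ler_nat.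
exact: max_card.
Qed.

(** * Finite covers and Scheffe sets *)

(* The cover picks one distribution out of each nonempty cell of the grid. *)
Lemma fdist_cover (R : realType) (T : finType) (N : nat) (U : fdist R T) :
  (0 < N)%N ->
  exists O : {fset fdist R T}, (#|` O| <= N.+1 ^ #|T|)%N /\
    forall D : fdist R T, exists2 Q, Q \in O & forall i, `|Q i - D i| <= N%:R^-1.
Proof.
move=> N0; have NR : 0 < N%:R :> R by rewrite ltr0n.
pose code (D : fdist R T) : {ffun T -> 'I_N.+1} :=
  [ffun i => inord (Num.truncn (N%:R * D i))].
(* Empty cells fall back on [U]; the covering property only visits cells that contain a
   distribution. *)
pose rep g := if pselect (exists D, code D = g) is left e
  then projT1 (cid e) else U.
exists (seq_fset tt [seq rep g | g <- enum {: {ffun T -> 'I_N.+1}}]); split.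
  rewrite size_seq_fset (leq_trans (size_undup _)) // size_map -cardE.
  by rewrite card_ffun card_ord.
move=> D; exists (rep (code D)).
  by rewrite seq_fsetE map_f // mem_enum.
have codeE : code (rep (code D)) = code D.
  rewrite /rep; case: pselect => [e|[]]; last by exists D.
  by case: (cid e).
move=> i; set Q := rep _ in codeE *.
have := congr1 (fun g : {ffun T -> 'I_N.+1} => val (g i)) codeE.
have le1 (P : fdist R T) : P i <= 1.
  by rewrite -(fdist_sum1 P) (bigD1 i) //= lerDl sumr_ge0 // => j _; exact: fdist_ge0.
have itv (P : fdist R T) : 0 <= N%:R * P i by rewrite mulr_ge0 ?fdist_ge0.
(* [N%:R * P i] can reach [N], hence [N.+1] codes per coordinate. *)
have small (P : fdist R T) : (Num.truncn (N%:R * P i) < N.+1)%N.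
  by rewrite truncn_lt_nat // -natr1 ltr_pwDr // ler_piMr.
rewrite /code !ffunE /= !inordK ?small // => E.
have /andP[q1 q2] := truncn_itv (itv Q); have /andP[d1 d2] := truncn_itv (itv D).
rewrite E in q1 q2; rewrite -!natr1 in q2 d2.
rewrite -(ler_pM2l NR) divff ?gt_eqF // -[X in X * _]ger0_norm // -normrM ler_norml.
by rewrite mulrBr; lra.
Qed.

(** [Q - D] sums to 0, so its positive part carries exactly half of the L1 norm. *)
Lemma dTV_scheffe (R : realType) (T : finType) (Q D : fdist R T) :
  Pr Q [set i | D i < Q i] - Pr D [set i | D i < Q i] = dTV Q D.
Proof.
set W := [set i | _].
have E : \sum_(i in W) (Q i - D i) + \sum_(i | i \notin W) (Q i - D i) = 0.
  have : \sum_i (Q i - D i) = 0 by rewrite sumrB !fdist_sum1 subrr.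
  by rewrite (bigID (mem W)).
rewrite /Pr -sumrB /dTV [X in _ = _ * X](bigID (mem W)) /=.
have -> : \sum_(i in W) `|Q i - D i| = \sum_(i in W) (Q i - D i).
  by apply: eq_bigr => i; rewrite inE => lt; rewrite gtr0_norm // subr_gt0.
have -> : \sum_(i | i \notin W) `|Q i - D i| = - \sum_(i | i \notin W) (Q i - D i).
  rewrite -sumrN; apply: eq_bigr => i; rewrite inE -leNgt => le.
  by rewrite ler0_norm // subr_le0.
lra.
Qed.

(** * Votes of the users and the loss *)

(** The scale [sqrt m'] makes the noise of a vote of order 1, so that a logarithmic [T] suffices,
    and turns a gap [alpha] into a signal [alpha * sqrt m']. *)
Definition user_vote (R : realType) (Z : finType) m (m' : nat) (T : R)
    (W : {set Z}) (q : R) (r : m.-tuple Z) : R :=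
  clip T (deviation W q (take m' r)).

(** [clip] is monotone, so [q] may be raised to [Pr D W + c], where [expect_clip_error] controls the
    mean. *)
Lemma user_vote_mean_le (R : realType) (Z : finType) (D : fdist R Z)
    m m' (T : R) (W : {set Z}) (q c : R) :
  (0 < m' <= m)%N -> 0 <= T -> q - Pr D W <= c -> 0 <= c * Num.sqrt m'%:R <= 1 ->
  \sum_r row_prob D r * @user_vote R Z m m' T W q r <=
  c * Num.sqrt m'%:R + 16 * expR (- T / 2).
Proof.
move=> /andP[m0 mm] T0 qc c01.
have -> : \sum_r row_prob D r * @user_vote R Z m m' T W q r =
    expect D m' (fun s => clip T (deviation W q s)).
  exact: (expect_take (fun s => clip T (deviation W q s)) (fdist_sum1 D) mm).
have H := expect_clip_error D W m0 T0 c01.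
apply: le_trans (_ : expect D m' (fun s => clip T (deviation W (Pr D W) s +
   c * Num.sqrt m'%:R)) <= _); last by move: H; rewrite ler_norml; lra.
apply: ler_expect => [z|s sz]; first exact: fdist_ge0.
apply: clip_le; rewrite (deviation_shift W q (Pr D W)) sz lerD2l.
by rewrite ler_wpM2r ?sqrtr_ge0.
Qed.

Lemma user_vote_mean_ge (R : realType) (Z : finType) (D : fdist R Z)
    m m' (T : R) (W : {set Z}) (q c : R) :
  (0 < m' <= m)%N -> 0 <= T -> c <= q - Pr D W -> 0 <= c * Num.sqrt m'%:R <= 1 ->
  c * Num.sqrt m'%:R - 16 * expR (- T / 2) <=
  \sum_r row_prob D r * @user_vote R Z m m' T W q r.
Proof.
move=> /andP[m0 mm] T0 qc c01.
have -> : \sum_r row_prob D r * @user_vote R Z m m' T W q r =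
    expect D m' (fun s => clip T (deviation W q s)).
  exact: (expect_take (fun s => clip T (deviation W q s)) (fdist_sum1 D) mm).
have H := expect_clip_error D W m0 T0 c01.
apply: (@le_trans _ _ (expect D m' (fun s => clip T (deviation W (Pr D W) s +
   c * Num.sqrt m'%:R)))); first by move: H; rewrite ler_norml; lra.
apply: ler_expect => [z|s sz]; first exact: fdist_ge0.
apply: clip_le; rewrite (deviation_shift W q (Pr D W)) sz lerD2l.
by rewrite ler_wpM2r ?sqrtr_ge0.
Qed.

(* When [Q] is far from the true distribution, the set [W] where [Q] exceeds it
   makes the sum large. *)
Definition scheffe_loss (R : realType) k m (m' : nat) (T : R)
    (t : seq (m.-tuple 'I_k)) (Q : fdist R 'I_k) : R :=
  \big[Num.max/0]_(W : {set 'I_k}) \sum_(r <- t) user_vote m' T W (Pr Q W) r.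

(** One vote stays in [[-T, T]], and a maximum is no more sensitive than its entries. *)
Lemma scheffe_loss_sensitivity (R : realType) k n m m' (T : R)
    (x x' : 'M['I_k]_(n, m)) (Q : fdist R 'I_k) :
  0 <= T -> user_neighbors x x' ->
  scheffe_loss m' T (rows x) Q <= scheffe_loss m' T (rows x') Q + 2 * T.
Proof.
move=> T0 [i xx'].
have rowE i' : i' != i -> tnth (rows x) i' = tnth (rows x') i'.
  move=> /xx'/rowP E; apply: eq_from_tnth => j; rewrite !tnth_mktuple.
  by have := E j; rewrite !mxE.
have vT W r : `|@user_vote R 'I_k m m' T W (Pr Q W) r| <= T by exact: clip_norm.
apply: bigmax_le => [|W _].
  rewrite addr_ge0 ?mulr_ge0 //.
  exact: bigmax_ge_id.
apply: (@le_trans _ _ (\sum_(r <- rows x') user_vote m' T W (Pr Q W) r + 2 * T)).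
  rewrite !big_tuple (bigD1 i) //= [X in _ <= X + _](bigD1 i) //=.
  rewrite (eq_bigr _ (fun j ji => congr1 _ (rowE j ji))).
  have := vT W (tnth (rows x) i); have := vT W (tnth (rows x') i).
  rewrite !ler_norml; lra.
rewrite lerD2r.
exact: (le_bigmax _ (fun W => \sum_(r <- rows x') user_vote m' T W (Pr Q W) r)).
Qed.

Lemma user_neighbors_sym (Z : finType) n m (x x' : 'M[Z]_(n, m)) :
  user_neighbors x x' -> user_neighbors x' x.
Proof. by case=> i xx'; exists i => i' /xx'. Qed.

(** * The upper bound *)

(** The failure probability 1/3 is split evenly: one premise pays for concentration, by a union over
    [2 ^ k] sets and all candidates, the other for the tail of the exponential mechanism. *)
Lemma DD_upper_bound (R : realType) k m m' n N (alpha eps T : R)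
    (U : fdist R 'I_k) :
  0 < alpha -> 0 < eps -> (0 < m' <= m)%N -> alpha * Num.sqrt m'%:R <= 1 ->
  1 <= T -> 16 * expR (- T / 2) <= alpha / 10 ->
  (0 < N)%N -> k%:R / N%:R <= alpha / 8 ->
  (2 ^ k + N.+1 ^ k)%:R *
    expR (- (n%:R * ((alpha * Num.sqrt m'%:R) ^+ 2 / (512 * T ^+ 2)))) <= 6^-1 ->
  (N.+1 ^ k)%:R *
    expR (- (eps / (4 * T) * (n%:R * (3 / 8 * (alpha * Num.sqrt m'%:R))))) <= 6^-1 ->
  solvable_with (DD k alpha) m eps 0 n.
Proof.
move=> a0 e0 mm; set ga := alpha * _ => ga1 T1 trunc N0 kN conc priv.
have /andP[m0 _] := mm.
have T0 : 0 <= T by apply: le_trans T1.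
have Tgt0 : 0 < T by apply: lt_le_trans T1.
have Tn0 : T != 0 by rewrite gt_eqF.
have sq1 : 1 <= Num.sqrt m'%:R :> R.
  by rewrite -[leLHS]sqrtr1 ler_wsqrtr // ler1n.
have aga : alpha <= ga by rewrite /ga ler_peMr // ltW.
have ga0 : 0 < ga by apply: lt_le_trans aga.
have [O [cardO cover]] := fdist_cover U N0.
have [o0' o0O _] := cover U; pose o0 : O := [` o0O]%fset.
(* The loss has sensitivity [2 * T], so the privacy cost is [2 * eta * (2 * T) = eps]. *)
pose eta := eps / (4 * T).
have eta0 : 0 <= eta by rewrite divr_ge0 ?mulr_ge0 // ltW.
pose L t (o : O) := @scheffe_loss R k m m' T t (val o).
pose A' t : fdist R O := FDist (expmech_fdist o0 eta (L t)).
exists O, (fun x => A' (rows x)); split.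
  move=> x x' xx' S; rewrite addr0 /Pr mulr_sumr; apply: ler_sum => o _ /=.
  have -> : eps = 2 * eta * (2 * T) by rewrite /eta; field.
  apply: expmech_ratio => // o'; apply: scheffe_loss_sensitivity => //.
  exact: user_neighbors_sym.
move=> D _; rewrite /success_prob sum_iid_prob.
pose far := [set o : O | ~~ (dTV (val o) D <= alpha)].
pose P := @row_prob R 'I_k m D.
have P0 r : 0 <= P r by apply: row_prob_ge0; exact: fdist_ge0.
have P1 : \sum_r P r = 1 by apply: sum_row_prob; exact: fdist_sum1.
have [Q QO Qnear] := cover D; pose q : O := [` QO]%fset.
have QW W : Pr Q W - Pr D W <= alpha / 8.
  apply: le_trans kN; rewrite /Pr -sumrB.
  apply: (@le_trans _ _ (\sum_(i < k) N%:R^-1)); last first.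
    by rewrite sumr_const card_ord mulr_natl.
  rewrite big_mkcond; apply: ler_sum => i _; case: ifP => _.
    by apply: le_trans (Qnear i); exact: ler_norm.
  by rewrite invr_ge0.
(* Minimises [2 * (la * T) ^+ 2 - la * ga / 8]; the minimum is the exponent per user in [rho]. *)
pose la := ga / (32 * T ^+ 2).
have la0 : 0 <= la.
  by apply: divr_ge0; [exact: ltW|rewrite mulr_ge0 ?sqr_ge0].
have laT : la * T <= 2^-1.
  rewrite (_ : la * T = ga / (32 * T)); last by rewrite /la; field.
  by rewrite ler_pdivrMr ?mulr_gt0 //; lra.
pose vote W (o : O) := @user_vote R 'I_k m m' T W (Pr (val o) W).
have vT W (o : O) r : `|vote W o r| <= T.
  by rewrite /vote; exact: clip_norm.
have vTN W (o : O) r : `|- vote W o r| <= T by rewrite normrN.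
(* One witness per far candidate is enough, which avoids a union over pairs of a candidate and a
   set. *)
pose Wf (o : O) := [set i | D i < val o i].
pose near_bad W t := expR (la * (\sum_(r <- t) vote W q r - n%:R * (3 / 8 * ga))).
pose far_bad o t :=
  expR (la * (\sum_(r <- t) (- vote (Wf o) o r) - n%:R * (- (3 / 4 * ga)))).
pose rho := expR (- (n%:R * (ga ^+ 2 / (512 * T ^+ 2)))).
have rhoE mu b : mu - b = - (ga / 8) ->
    expR (n%:R * (la * (mu - b) + 2 * (la * T) ^+ 2)) = rho.
  by move=> ->; rewrite /rho; congr expR; rewrite /la; field.
(* The mean is at most [ga / 8] from the cover plus [alpha / 10] from clipping, hence at most
   [ga / 4], which is [ga / 8] below the threshold. *)
have near_le W : expect P n (near_bad W) <= rho.
  rewrite -(rhoE (ga / 4) (3 / 8 * ga)); last by field.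
  apply: expect_expR_sum => //.
  have := user_vote_mean_le mm T0 (QW W).
  have -> : alpha / 8 * Num.sqrt m'%:R = ga / 8 by rewrite /ga; ring.
  move=> H; apply: (le_trans (H _)); clear - ga0 ga1 aga trunc;
    [apply/andP; split|]; lra.
(* The mean vote is at least [ga - alpha / 10 >= 7 / 8 * ga], again [ga / 8] away from the
   threshold. *)
have far_le (o : O) : o \in far -> expect P n (far_bad o) <= rho.
  rewrite inE -ltNge -dTV_scheffe => /ltW ofar.
  rewrite -(rhoE (- (7 / 8 * ga)) (- (3 / 4 * ga))); last by field.
  apply: expect_expR_sum => //.
  under eq_bigr do rewrite mulrN.
  rewrite sumrN lerN2.
  have H := user_vote_mean_ge mm T0 ofar.
  apply: le_trans (H _); rewrite -/ga; clear - ga0 ga1 aga trunc;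
    [|apply/andP; split]; lra.
(* Pointwise union bound: a violated threshold makes its exponential at least 1; otherwise the
   losses are [n%:R * (3 / 8 * ga)] apart and the mechanism's tail applies. *)
have fail t : size t = n -> \sum_(o in far) A' t o <=
    6^-1 + (\sum_W near_bad W t + \sum_(o in far) far_bad o t).
  move=> sz.
  have nb0 : 0 <= \sum_W near_bad W t by apply: sumr_ge0 => W _; exact: expR_ge0.
  have fb0 : 0 <= \sum_(o in far) far_bad o t.
    by apply: sumr_ge0 => o _; exact: expR_ge0.
  have Pfar1 : \sum_(o in far) A' t o <= 1 by exact: Pr_le1.
  case: (boolP [forall W, \sum_(r <- t) vote W q r <= n%:R * (3 / 8 * ga)])
      => [/forallP near|]; last first.
    case/forallPn => W; rewrite -ltNge => bad.
    have : 1 <= near_bad W t.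
      by rewrite -expR0 ler_expR mulr_ge0 // subr_ge0 ltW.
    have : near_bad W t <= \sum_W near_bad W t.
      by rewrite [leRHS](bigD1 W) //= lerDl; apply: sumr_ge0 => ? _; exact: expR_ge0.
    lra.
  case: (boolP [forall o in far, n%:R * (3 / 4 * ga) <= \sum_(r <- t) vote (Wf o) o r])
      => [/forall_inP farok|]; last first.
    rewrite negb_forall => /existsP[o]; rewrite negb_imply => /andP[ofar].
    rewrite -ltNge => bad.
    have : 1 <= far_bad o t.
      by rewrite -expR0 ler_expR mulr_ge0 // sumrN mulrN opprK addrC subr_ge0 ltW.
    have : far_bad o t <= \sum_(o in far) far_bad o t.
      by rewrite [leRHS](bigD1 o) //= lerDl; apply: sumr_ge0 => ? _; exact: expR_ge0.
    lra.
  have Lq : L t q <= n%:R * (3 / 8 * ga).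
    apply: bigmax_le => [|W _]; last exact: near.
    by apply: mulr_ge0 => //; lra.
  have Lfar o : o \in far -> n%:R * (3 / 4 * ga) <= L t o.
    move=> ofar; apply: (le_trans (farok o ofar)).
    exact: (le_bigmax _ (fun W => \sum_(r <- t) vote W o r)).
  have H := expmech_tail eta0 Lq Lfar.
  have : \sum_(o in far) A' t o <= 6^-1.
    apply: (le_trans H); apply: le_trans priv; apply: ler_pM => //.
    - exact: expR_ge0.
    - by rewrite ler_nat -cardfE (leq_trans cardO) // card_ord.
    - rewrite ler_expR lerN2 -/eta ler_wpM2l //.
      by rewrite le_eqVlt; apply/orP; left; apply/eqP; field.
  lra.
have succ t : size t = n ->
    1 - (6^-1 + (\sum_W near_bad W t + \sum_(o in far) far_bad o t)) <=
    Pr (A' t) [set o : O | @correct _ (DD k alpha) D (val o)].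
  move=> /fail; rewrite lerBlDr => /(lerD (lexx (Pr (A' t)
    [set o : O | @correct _ (DD k alpha) D (val o)]))); apply: le_trans.
  rewrite -(fdist_sum1 (A' t)) (bigID (mem [set o : O | dTV (val o) D <= alpha])) /=.
  rewrite lerD2l le_eqVlt; apply/orP; left; apply/eqP/eq_bigl => o.
  by rewrite !inE.
apply: (@le_trans _ _ (expect P n (fun t => Pr (A' t)
    [set o : O | @correct _ (DD k alpha) D (val o)]))); last first.
  rewrite le_eqVlt; apply/orP; left; apply/eqP; apply: eq_bigr => t _.
  by rewrite mx_of_rowsK.
apply: le_trans (ler_expect P0 succ).
have -> : expect P n (fun t =>
    1 - (6^-1 + (\sum_W near_bad W t + \sum_(o in far) far_bad o t))) =
  1 - (6^-1 + (\sum_W expect P n (near_bad W) +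
    \sum_(o in far) expect P n (far_bad o))).
  rewrite -!expect_sum -expectD -[X in 1 - (X + _)](expect_cst n _ P1) -expectD.
  rewrite -[X in _ = X - _](expect_cst n _ P1) -[X in _ = _ - X]mul1r -mulNr.
  by rewrite -expectZ -expectD; apply: eq_expect => t _; rewrite mulN1r.
have : \sum_W expect P n (near_bad W) + \sum_(o in far) expect P n (far_bad o) <=
    6^-1.
  apply: le_trans conc; rewrite natrD mulrDl; apply: lerD.
    apply: (@le_trans _ _ (\sum_(W : {set 'I_k}) rho)).
      by apply: ler_sum => W _; exact: near_le.
    by rewrite sumr_const -cardsT -powersetT card_powerset cardsT card_ord mulr_natl.
  apply: (@le_trans _ _ (\sum_(o in far) rho)); first by apply: ler_sum => o; exact: far_le.
  rewrite sumr_const -[leLHS]mulr_natl ler_wpM2r ?expR_ge0 // ler_nat.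
  by rewrite (leq_trans (max_card _)) // -cardfE (leq_trans cardO) // card_ord.
lra.
Qed.

(** * Choice of parameters and rates *)

(* More than [alpha^-2] examples per user do not help any further, so the
   surplus is dropped. *)
Lemma effective_sample_size (R : realType) (alpha eps : R) m :
  0 < alpha <= 1 -> 0 < eps <= 2^-1 -> (0 < m)%N ->
  exists m', [/\ (0 < m' <= m)%N, alpha * Num.sqrt m'%:R <= 1 &
    ((alpha * Num.sqrt m'%:R) ^+ 2)^-1 + (eps * (alpha * Num.sqrt m'%:R))^-1 <=
    4 * (eps^-1 + (alpha * eps * Num.sqrt m%:R)^-1 + (alpha ^+ 2 * m%:R)^-1)].
Proof.
move=> /andP[a0 a1] /andP[e0 e1] m0.
have a2 : 0 < alpha ^+ 2 by rewrite exprn_gt0.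
have a21 : alpha ^+ 2 <= 1 by rewrite expr_le1 // ltW.
have mR : 0 < m%:R :> R by rewrite ltr0n.
have sm : 0 < Num.sqrt m%:R :> R by rewrite sqrtr_gt0.
have ie : 0 < eps^-1 by rewrite invr_gt0.
have i1 : 0 < (alpha * eps * Num.sqrt m%:R)^-1 by rewrite invr_gt0 !mulr_gt0.
have i2 : 0 < (alpha ^+ 2 * m%:R)^-1 by rewrite invr_gt0 mulr_gt0.
pose p := Num.truncn (alpha ^+ 2)^-1.
have ia1 : 1 <= (alpha ^+ 2)^-1 by rewrite invf_ge1.
have /andP[p1 p2] := truncn_itv (le_trans ler01 ia1).
have p0 : (0 < p)%N by rewrite truncn_gt0.
have gamma_le1 q : (q <= p)%N -> alpha * Num.sqrt q%:R <= 1.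
  move=> qp; rewrite -(@ler_pXn2r _ 2) ?nnegrE ?mulr_ge0 ?sqrtr_ge0 ?(ltW a0) //.
  rewrite exprMn sqr_sqrtr // expr1n mulrC -ler_pdivlMr // mul1r.
  by apply: le_trans p1; rewrite ler_nat.
case: (leqP m p) => mp.
  exists m; split; [by rewrite m0 /=|exact: gamma_le1|].
  rewrite exprMn sqr_sqrtr ?(ltW mR) // (mulrA eps) (mulrC eps).
  by move: ie i1 i2; lra.
exists p; split; [by rewrite p0 ltnW|exact: gamma_le1|].
set ga := alpha * _.
have pR : 0 < p%:R :> R by rewrite ltr0n.
have ga0 : 0 < ga by rewrite mulr_gt0 // sqrtr_gt0.
have ga1 : ga <= 1 by exact: gamma_le1.
(* Rounding down loses at most half: [1 < alpha ^+ 2 * (p + 1) <= 2 * alpha ^+ 2 * p]. *)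
have ga2 : 2^-1 <= ga ^+ 2.
  rewrite exprMn sqr_sqrtr ?(ltW pR) //.
  have p1' : 1 <= p%:R :> R by rewrite ler1n.
  have : (alpha ^+ 2)^-1 < p%:R + 1 by rewrite natr1.
  rewrite -(ltr_pM2l a2) divff ?gt_eqF // => H.
  have : alpha ^+ 2 * 1 <= alpha ^+ 2 * p%:R by rewrite ler_pM2l.
  lra.
have ga3 : 2^-1 <= ga by apply: (le_trans ga2); rewrite expr2 ler_piMr // ltW.
have g1 : (ga ^+ 2)^-1 <= 2.
  by rewrite -[leRHS]invrK lef_pV2 ?posrE ?invr_gt0 // exprn_gt0.
have g2 : ga^-1 <= 2.
  by rewrite -[leRHS]invrK lef_pV2 ?posrE ?invr_gt0.
have e2 : 2 <= eps^-1.
  by rewrite -[leLHS]invrK lef_pV2 ?posrE ?invr_gt0.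
have : (eps * ga)^-1 <= 2 * eps^-1.
  by rewrite invfM mulrC ler_pM2r.
by move: i1 i2; lra.
Qed.

Lemma ln_le_double (R : realType) (X y : R) :
  1 <= X -> 0 < y <= X * X -> ln y <= 2 * ln X.
Proof.
move=> X1 /andP[y0 yX].
have X0 : 0 < X by apply: lt_le_trans X1.
rewrite mulr_natl mulr2n -lnM ?posrE // ler_ln ?posrE //.
by rewrite mulr_gt0.
Qed.

Lemma fdist_ord (R : realType) k : (1 < k)%N -> fdist R 'I_k.
Proof.
case: k => // h h0; apply: FDist; apply: (@perturbed_fdist R h (fun=> 0)) => //.
by move=> j; rewrite lexx ler01.
Qed.

(** Two logarithms come from [T ^+ 2] and one from the size of the cover; the [+ 1] pays for
    rounding [n] up. *)
Lemma DD_upper_rate (R : realType) k m (alpha eps : R) :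
  (1 < k)%N -> 0 < alpha <= 160^-1 -> 0 < eps <= 2^-1 -> (0 < m)%N ->
  exists2 n, solvable_with (DD k alpha) m eps 0 n &
    n%:R <= (512 * 128 + 1) * ln (k%:R / (alpha * eps)) ^+ 3 * DD_rate k m alpha eps.
Proof.
move=> k1 /andP[a0 a1] /andP[e0 e1] m0.
have an0 : alpha != 0 by rewrite gt_eqF.
have en0 : eps != 0 by rewrite gt_eqF.
have k2 : 2 <= k%:R :> R by rewrite ler_nat.
have k0 : 0 < k%:R :> R by apply: lt_le_trans k2.
pose ia := alpha^-1.
have ia0 : 160 <= ia by rewrite -[leLHS]invrK lef_pV2 ?posrE ?invr_gt0.
have ie0 : 2 <= eps^-1 by rewrite -[leLHS]invrK lef_pV2 ?posrE ?invr_gt0.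
pose X := k%:R / (alpha * eps).
have XE : X = k%:R * ia * eps^-1 by rewrite /X invfM mulrA.
have kiaX : 2 * (k%:R * ia) <= X.
  rewrite XE mulrC; apply: ler_pM => //; rewrite mulr_ge0 // ?ltW //; lra.
have ki : 2 * ia <= k%:R * ia by rewrite ler_wpM2r //; lra.
have X1 : 160 <= X by lra.
have X0 : 0 < X by lra.
pose L := ln X.
have L1 : 1 <= L.
  rewrite -[leLHS](expRK 1) ler_ln ?posrE ?expR_gt0 //.
  by apply: (le_trans (expR1_le4 R)); lra.
(* Makes [16 * expR (- T / 2)] equal to [alpha / 10]. *)
pose T := 2 * ln (160 * ia).
have T1 : 1 <= T.
  have : 1 <= ln (160 * ia).
    rewrite -[leLHS](expRK 1) ler_ln ?posrE ?expR_gt0 //; last by lra.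
    by apply: (le_trans (expR1_le4 R)); lra.
  by rewrite /T; lra.
have TL : T <= 4 * L.
  have : ln (160 * ia) <= 2 * L.
    apply: ln_le_double; [by lra|apply/andP; split; [by lra|]].
    by apply: ler_pM; lra.
  by rewrite /T; lra.
have trunc : 16 * expR (- T / 2) <= alpha / 10.
  have -> : - T / 2 = - ln (160 * ia) by rewrite /T; field.
  rewrite expRN lnK ?posrE; last by lra.
  by rewrite /ia invfM invrK; lra.
pose N := (Num.truncn (8 * k%:R * ia)).+1.
have pos8 : 0 <= 8 * k%:R * ia by rewrite !mulr_ge0 //; lra.
have /andP[N1 N2] := truncn_itv pos8.
have NR : 0 < N%:R :> R by rewrite ltr0n.
have kN : k%:R / N%:R <= alpha / 8.
  rewrite ler_pdivrMr //.
  have : alpha * (8 * k%:R * ia) <= alpha * N%:R by rewrite ler_pM2l // ltW.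
  rewrite (_ : alpha * _ = 8 * k%:R); last by rewrite /ia; field.
  lra.
have Nle : N.+1%:R <= 10 * (k%:R * ia).
  by rewrite -[N.+1%:R]natr1 -[N%:R]natr1; lra.
(* [expR Lam] dominates six times the count in either union bound, so an exponent of at least [Lam]
   leaves failure probability 1/6. *)
pose Lam : R := k%:R * ln (12 * N.+1%:R).
have N12 : 1 <= 12 * N.+1%:R :> R.
  have : 1 <= N.+1%:R :> R by rewrite ler1n.
  lra.
have Lam0 : 0 <= Lam by rewrite mulr_ge0 ?ln_ge0 // ltW.
have LamL : Lam <= k%:R * (2 * L).
  rewrite /Lam ler_pM2l //; apply: ln_le_double; [by lra|].
  apply/andP; split; first by lra.
  apply: (@le_trans _ _ (120 * (k%:R * ia))); first by lra.
  by apply: ler_pM; lra.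
have expLam : expR Lam = (12 * N.+1%:R) ^+ k.
  by rewrite /Lam expRM_natl lnK // posrE; apply: lt_le_trans N12.
have card1 : 12 * (N.+1 ^ k)%:R <= expR Lam.
  rewrite expLam exprMn natrX ler_wpM2r ?exprn_ge0 //.
  by rewrite -[leLHS]expr1 ler_weXn2l ?ler1n // ltnW.
have card2 : 6 * (2 ^ k + N.+1 ^ k)%:R <= expR Lam.
  apply: le_trans card1; rewrite natrD.
  have : (2 ^ k)%:R <= (N.+1 ^ k)%:R :> R by rewrite ler_nat leq_exp2r // ltnW.
  lra.
have small (M : nat) (E : R) : 6 * M%:R <= expR Lam -> Lam <= E ->
    M%:R * expR (- E) <= 6^-1.
  move=> ML LE; rewrite expRN ler_pdivrMr ?expR_gt0 //.
  have : expR Lam <= expR E by rewrite ler_expR.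
  lra.
have [|||m' [mm ga1 rate]] := @effective_sample_size R alpha eps m.
- by rewrite a0 /=; lra.
- by rewrite e0.
- exact: m0.
set ga := alpha * _ in ga1 rate.
have ga0 : 0 < ga.
  by case/andP: mm => m'0 _; rewrite mulr_gt0 // sqrtr_gt0 ltr0n.
have gan0 : ga != 0 by rewrite gt_eqF.
have T0 : 0 < T by apply: lt_le_trans T1.
have Tn0 : T != 0 by rewrite gt_eqF.
(* The first summand is the concentration requirement; the second more than covers privacy, as
   [T >= 1]. *)
pose b := 512 * T ^+ 2 * Lam * ((ga ^+ 2)^-1 + (eps * ga)^-1).
have c0 : 0 <= 512 * T ^+ 2 * Lam.
  by apply: mulr_ge0 => //; rewrite mulr_ge0 ?sqr_ge0.
have ig0 : 0 < (ga ^+ 2)^-1 by rewrite invr_gt0 exprn_gt0.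
have ieg0 : 0 < (eps * ga)^-1 by rewrite invr_gt0 mulr_gt0.
have b0 : 0 <= b by apply: mulr_ge0 => //; clear - ig0 ieg0; lra.
have /andP[b1 b2] := truncn_itv b0.
exists (Num.truncn b).+1; first set n := _.+1.
  have nb1 : 512 * T ^+ 2 * Lam * (ga ^+ 2)^-1 <= n%:R.
    apply: le_trans (ltW b2); rewrite /b ler_wpM2l //; clear - ig0 ieg0; lra.
  have nb2 : 512 * T ^+ 2 * Lam * (eps * ga)^-1 <= n%:R.
    apply: le_trans (ltW b2); rewrite /b ler_wpM2l //; clear - ig0 ieg0; lra.
  apply: (@DD_upper_bound R k m m' n N alpha eps T (fdist_ord R k1)) => //.
  - apply: small => //.
    apply: (@le_trans _ _ (512 * T ^+ 2 * Lam * (ga ^+ 2)^-1 *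
       (ga ^+ 2 / (512 * T ^+ 2)))).
      rewrite le_eqVlt; apply/orP; left; apply/eqP; field.
      by rewrite gan0 Tn0.
    rewrite ler_wpM2r //; apply: divr_ge0; first exact: sqr_ge0.
    by rewrite mulr_ge0 ?sqr_ge0.
  - apply: small.
      by apply: le_trans card1; rewrite ler_wpM2r // ler_nat.
    apply: (@le_trans _ _ (48 * T * Lam)).
      by rewrite ler_peMl //; clear - T1; lra.
    apply: (@le_trans _ _ (eps / (4 * T) *
        ((512 * T ^+ 2 * Lam * (eps * ga)^-1) * (3 / 8 * ga)))).
      rewrite le_eqVlt; apply/orP; left; apply/eqP; field.
      by rewrite gan0 Tn0 en0.
    rewrite ler_wpM2l //; first by rewrite divr_ge0 ?ltW // mulr_gt0.
    by rewrite ler_wpM2r //; clear - ga0; lra.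
have rateE : DD_rate k m alpha eps =
    k%:R * (eps^-1 + (alpha * eps * Num.sqrt m%:R)^-1 + (alpha ^+ 2 * m%:R)^-1).
  by rewrite /DD_rate !mulrDr.
set V := _ + _ + _ in rate rateE.
have V2 : 2 <= V.
  have : 0 <= (alpha * eps * Num.sqrt m%:R)^-1.
    by rewrite invr_ge0 !mulr_ge0 ?sqrtr_ge0 // ltW.
  have : 0 <= (alpha ^+ 2 * m%:R)^-1 by rewrite invr_ge0 mulr_ge0 ?sqr_ge0.
  rewrite /V; lra.
have rate1 : 1 <= DD_rate k m alpha eps.
  by rewrite rateE -[leLHS]mulr1; clear - k2 V2; apply: ler_pM; lra.
have L31 : 1 <= L ^+ 3 by rewrite exprn_ege1.
have bB : b <= 512 * 128 * L ^+ 3 * DD_rate k m alpha eps.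
  apply: (@le_trans _ _ (512 * (4 * L) ^+ 2 * (k%:R * (2 * L)) * (4 * V))).
    rewrite /b; apply: ler_pM => //; first by lra.
    apply: ler_pM => //; first by rewrite mulr_ge0 ?sqr_ge0.
    rewrite ler_pM2l // lerXn2r ?nnegrE //; clear - T1 TL L1; lra.
  rewrite rateE le_eqVlt; apply/orP; left; apply/eqP; ring.
have LR1 : 1 <= L ^+ 3 * DD_rate k m alpha eps.
  by rewrite -[leLHS]mulr1; apply: ler_pM.
rewrite -natr1 -/X -/L -mulrA mulrDl mul1r mulrA; apply: lerD => //.
exact: le_trans bB.
Qed.

(** Each summand of the rate is bounded separately; [k <= 2 * (k - 1)] doubles the constants. *)
Lemma DD_lower_rate (R : realType) k m n (alpha eps : R) :
  (1 < k)%N -> 0 < alpha <= 5184^-1 -> 0 < eps <= 2^-1 -> (0 < m)%N ->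
  solvable_with (DD k alpha) m eps 0 n ->
  DD_rate k m alpha eps <= (8 + 12 * 5184 + 2 * 5184 ^+ 2) * n%:R.
Proof.
case: k => // h h0 a01 e01 m0 /(DD_lower_bound h0 a01 e01)[].
have /andP[a0 _] := a01; have /andP[e0 _] := e01.
have mR : 0 < m%:R :> R by rewrite ltr0n.
have sm : 0 < Num.sqrt m%:R :> R by rewrite sqrtr_gt0.
move: (5184 : R) => v L1 L2 L3.
have hk : h.+1%:R <= 2 * h%:R :> R.
  have : 1 <= h%:R :> R by rewrite ler1n.
  by rewrite -natr1; lra.
rewrite /DD_rate !(mulrDl _ _ n%:R).
apply: lerD; first apply: lerD; rewrite ler_pdivrMr ?mulr_gt0 ?exprn_gt0 //.
- by move: hk L2; lra.
- by move: hk L3; lra.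
- by move: hk L1; rewrite exprMn; lra.
Qed.

(** * Matching bounds for the user complexity *)

Lemma is_user_complexity_exists (R : realType) (t : task R) m (eps delta : R) n :
  solvable_with t m eps delta n ->
  exists2 n', is_user_complexity t m eps delta n' & (n' <= n)%N.
Proof.
move=> sn.
have ex : exists n, `[< solvable_with t m eps delta n >] by exists n; apply/asboolP.
case: (ex_minnP ex) => n' /asboolP sn' min.
exists n'; last by apply: min; apply/asboolP.
by split => // p sp; apply: min; apply/asboolP.
Qed.

(** For [k = 1] a constant answer makes the complexity 0 while the rate is positive, and for [m = 0]
    the users hold no data; hence [1 < k] and [0 < m]. *)
Theorem theoremE8 (R : realType) :
  exists (alpha0 eps0 C : R) (c : nat),
    [/\ 0 < alpha0, 0 < eps0, 0 < C &
      forall (k : nat) (alpha eps : R) (m : nat),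
        (1 < k)%N -> 0 < alpha < alpha0 -> 0 < eps < eps0 -> (0 < m)%N ->
        exists n : nat,
          [/\ is_user_complexity (DD k alpha) m eps 0 n,
              DD_rate k m alpha eps / polylog C c k alpha eps <= n%:R &
              n%:R <= polylog C c k alpha eps * DD_rate k m alpha eps]].
Proof.
(* [v >= 512] makes [3 * v ^+ 2] dominate both [8 + 12 * v + 2 * v ^+ 2] and the constant
   [512 * 128 + 1] of the upper bound. *)
have [v v512 lower] : exists2 v : R, 512 <= v &
    forall k m n alpha eps, (1 < k)%N -> 0 < alpha <= v^-1 ->
      0 < eps <= 2^-1 -> (0 < m)%N -> solvable_with (DD k alpha) m eps 0 n ->
      DD_rate k m alpha eps <= (8 + 12 * v + 2 * v ^+ 2) * n%:R.
  by exists 5184; [rewrite ler_nat|exact: DD_lower_rate].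
have v0 : 0 < v by apply: lt_le_trans v512; rewrite ltr0n.
have C0 : 0 < 3 * v ^+ 2 by rewrite mulr_gt0 ?exprn_gt0.
exists v^-1, 2^-1, (3 * v ^+ 2), 3%N; split; rewrite ?invr_gt0 //.
move=> k alpha eps m k1 /andP[a0 a1] /andP[e0 e1] m0.
have e01 : 0 < eps <= 2^-1 by rewrite e0 ltW.
have a01 : 0 < alpha <= v^-1 by rewrite a0 ltW.
have a160 : 0 < alpha <= 160^-1.
  rewrite a0; apply: (le_trans (ltW a1)).
  by rewrite lef_pV2 ?posrE ?ltr0n //; apply: le_trans v512; rewrite ler_nat.
have [n sn nle] := DD_upper_rate k1 a160 e01 m0.
have [n' cn' n'n] := is_user_complexity_exists sn.
have [sn' _] := cn'.
have L1 : 1 <= ln (k%:R / (alpha * eps)).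
  have X4 : expR 1 <= k%:R / (alpha * eps).
    apply: (le_trans (expR1_le4 R)).
    have k2 : 2 <= k%:R :> R by rewrite ler_nat.
    rewrite ler_pdivlMr ?mulr_gt0 //; apply: le_trans k2.
    have a1' : alpha <= 1.
      by case/andP: a160 => _ /le_trans; apply; rewrite invf_le1 ?ltr0n ?ler1n.
    have : alpha * eps <= 1 * eps by rewrite ler_wpM2r // ltW.
    by move: e1; clear; lra.
  rewrite -[leLHS](expRK 1) ler_ln ?posrE ?expR_gt0 //.
  exact: lt_le_trans (expR_gt0 1) X4.
have rate0 : 0 <= DD_rate k m alpha eps.
  have := ltW a0; have := ltW e0 => ? ?.
  by rewrite /DD_rate !addr_ge0 ?divr_ge0 ?mulr_ge0 ?sqrtr_ge0 ?sqr_ge0.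
have L31 : 1 <= ln (k%:R / (alpha * eps)) ^+ 3 by rewrite exprn_ege1.
have L30 := lt_le_trans ltr01 L31.
have pl0 : 0 < polylog (3 * v ^+ 2) 3 k alpha eps by apply: mulr_gt0.
exists n'; split=> //.
  rewrite ler_pdivrMr //.
  apply: (le_trans (lower _ _ _ _ _ k1 a01 e01 m0 sn')).
  rewrite mulrC ler_wpM2l //.
  apply: (@le_trans _ _ (3 * v ^+ 2)); last by rewrite /polylog ler_peMr // ltW.
  by move: v512; clear; nra.
apply: (@le_trans _ _ n%:R); first by rewrite ler_nat.
apply: (le_trans nle); rewrite /polylog ler_wpM2r // ler_wpM2r ?ltW //.
by move: v512; clear; nra.
Qed.
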